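(* Let $k\ge 1$ be an integer and let $P_k(z)=\prod_{n=1}^{\infty}\frac{1}{1-z^{n^k}}$ for $|z|<1$. Then the Khinchin family $(X^{[k]}_t)_{t\in[0,1)}$ associated with $P_k$ is strongly Gaussian.
   Context: Let $\mathcal{K}$ be the class of nonconstant power series $f(z)=\sum_{n\ge 0}a_nz^n$ with nonnegative coefficients, radius of convergence $R>0$, and $a_0>0$. The Khinchin family of $f\in\mathcal{K}$ is the family $(X_t)_{t\in[0,R)}$ of random variables with values in $\{0,1,2,\dots\}$ with $\mathbb{P}(X_t=n)=a_nt^n/f(t)$ for $t\in(0,R)$, $n\ge 0$, and $X_0\equiv 0$. Its mean and variance are $m_f(t)=\mathbb{E}(X_t)=tf'(t)/f(t)$ and $\sigma_f^2(t)=\mathbb{V}(X_t)=t\,m_f'(t)$; one has $\sigma_f(t)>0$ for $t\in(0,R)$, and the normalized variable is $\breve{X}_t=(X_t-m_f(t))/\sigma_f(t)$ for $t\in(0,R)$. The power series $f$ (or its Khinchin family) is called strongly Gaussian if $\lim_{t\uparrow R}\sigma_f^2(t)=+\infty$ and $$\lim_{t\uparrow R}\int_{-\pi\sigma_f(t)}^{\pi\sigma_f(t)}\big|\mathbb{E}(e^{i\theta\breve{X}_t})-e^{-\theta^2/2}\big|\,d\theta=0.$$ $P_k(z)=\sum_{n\ge0}p_k(n)z^n$ is the generating function of partitions into $k$-th powers of positive integers; it belongs to $\mathcal{K}$ and has radius of convergence $R=1$. *)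

(* Defs.v *)
From HB Require Import structures.
From mathcomp Require Import all_boot all_order all_algebra.
From mathcomp Require Import all_classical all_reals all_analysis.
From mathcomp Require Import complex.

Set Implicit Arguments.
Unset Strict Implicit.
Unset Printing Implicit Defensive.

Import Order.TTheory GRing.Theory Num.Theory.
Import numFieldNormedType.Exports.

Local Open Scope classical_set_scope.
Local Open Scope ring_scope.

(* A power series is given by its coefficient sequence a : nat -> R. *)

Definition cvg_radius (R : realType) (a : nat -> R) : \bar R :=
  ereal_sup [set `|x|%:E | x in [set x : R | cvgn (pseries a x)]].

Definition classK (R : realType) (a : nat -> R) : Prop :=
  [/\ forall n, 0 <= a n,
      (0 < cvg_radius a)%E,
      0 < a 0%N
    & exists2 n, (0 < n)%N & a n != 0].

(* Only the law of each X_t matters, so every X_t may live on its own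
   probability space; the values at t outside [0, cvg_radius a) are irrelevant. *)
Definition khinchin_family (R : realType) (a : nat -> R)
    (d : R -> measure_display) (T : forall t, measurableType (d t))
    (P : forall t, probability (T t) R) (X : forall t, {RV (P t) >-> nat}) :
    Prop :=
  (forall w, X 0 w = 0%N) /\
  (forall t : R, 0 < t -> (t%:E < cvg_radius a)%E -> forall n : nat,
    P t (X t @^-1` [set n]) = (a n * t ^+ n / limn (pseries a t))%:E).

Section RandomVariable.
Context (R : realType) (d : measure_display) (T : measurableType d).
Variables (P : probability T R) (Y : T -> R).

Definition mean : R := fine 'E_P[Y].

Definition stddev : R := Num.sqrt (fine 'V_P[Y]).

Definition normalized (w : T) : R := (Y w - mean) / stddev.

(* E(e^{i theta Y}), the expectation being taken on real and imaginary parts. *)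
Definition char_fun (theta : R) : R[i] :=
  (fine 'E_P[fun w => cos (theta * Y w)] +i*
   fine 'E_P[fun w => sin (theta * Y w)])%C.

End RandomVariable.

Definition gaussian_defect (R : realType) (d : measure_display)
    (T : measurableType d) (P : probability T R) (Y : T -> R) : \bar R :=
  let s := stddev P Y in
  (\int[@lebesgue_measure R]_(theta in `[(- (pi * s))%R, (pi * s)%R])
    (Normc.normc (char_fun P (normalized P Y) theta
            - (expR (- (theta ^+ 2 / 2)))%:C%C)%R)%:E)%E.

(* The endpoint r of the parameter interval is taken finite. *)
Definition strongly_gaussian (R : realType) (r : R)
    (d : R -> measure_display) (T : forall t, measurableType (d t))
    (P : forall t, probability (T t) R) (X : forall t, {RV (P t) >-> nat}) :
    Prop :=
  let Y t : T t -> R := fun w => (X t w)%:R in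
  'V_(P t)[Y t]%E @[t --> r^'-] --> +oo%E /\
  gaussian_defect (P t) (Y t) @[t --> r^'-] --> 0%E.

(* The number of partitions of n into k-th powers of positive integers, for
   1 <= k: m i is the multiplicity of the part (i + 1)^k. Parts and
   multiplicities are at most n, so the two bounds lose nothing. *)
Definition power_partitions (k n : nat) : nat :=
  #|[set m : {ffun 'I_n -> 'I_n.+1} | (\sum_(i < n) m i * i.+1 ^ k == n)%N]|.

Definition Pcoef (R : realType) (k n : nat) : R := (power_partitions k n)%:R.

(* R[i] gets its usual topology through the regular algebra R[i]^o. *)
Definition Pprod (R : realType) (k : nat) (z : R[i]) : (R[i]^o)^nat :=
  fun N => \prod_(1 <= n < N.+1) (1 - z ^+ (n ^ k)%N)^-1.

Definition Pseries (R : realType) (k : nat) (z : R[i]) : (R[i]^o)^nat :=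
  [series ((Pcoef R k n)%:C%C * z ^+ n : R[i]^o)]_n.

(* Main.v *)
Require Import Defs.
From HB Require Import structures.
From mathcomp Require Import all_boot all_order all_algebra.
From mathcomp Require Import all_classical all_reals all_analysis.
From mathcomp Require Import measurable_realfun complex.
From mathcomp Require Import zify ring lra.

(** The generating function P_k is a product over the parts m = j^k of geometric
    series in z^m. Hence X_t has the law of the sum of the m G_m, where the
    multiplicities G_m are independent geometric variables with parameter t^m, and
    its characteristic function is an explicit infinite product. Everything is
    read off this product; partitions enter only through the recursion [pcountS],
    which yields the product formula ([Pcoef_genfunC]) as well as the mean and
    variance as sums over the parts ([Pcoef_moments]).

    Put s = 1 - t and let N be the largest integer with 2 s N^k <= 1, so that N
    tends to infinity as t tends to 1. The parts m = j^k with j <= N satisfy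
    m s <= 1/2 and contribute at least 1 / (2 s^2) each to the variance; the
    contribution of the larger ones decays exponentially in m s, so that the
    variance sigma^2 lies between constant multiples of N / s^2 ([partial_var_ge], [partial_var_le]). In
    particular it tends to infinity.

    Two bounds on the normalized characteristic function phi(u / sigma) then give
    the Gaussian limit in L^1 ([khinchin_estimates]). First, the Lyapunov argument:
    replacing each factor by the Gaussian of the same variance costs its third
    absolute moment times |u / sigma|^3 ([geom_char_gauss]), and these add up to
    O(N s^(-3) |u|^3 sigma^(-3)) = O(|u|^3 N^(-1/2)). Second, a domination by
    C / (1 + u^2) on |u| <= pi sigma ([char_domination]). The squared modulus of
    the factor of m at theta is the inverse of 1 + 4 v sin^2(m theta / 2), where
    v >= 1 / (2 (m s)^2) for j <= N. When m |theta| <= 2 this is at least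
    1 + theta^2 / (8 s^2), whatever m is, and for small theta enough parts satisfy
    this condition. When theta is bounded below, sin (m theta / 2) cannot be small
    for two coprime values of m simultaneously unless sin (theta / 2) is
    ([sin_coprime]); so m = 1, one of 2^k, 3^k and one of 5^k, 7^k contribute a
    factor of order s each to phi, and s^3 is at most of order sigma^(-2).

    The integrand of the defect is thus bounded by the minimum of C |u|^3 N^(-1/2)
    and C / (1 + u^2), whose integral tends to 0 as N tends to infinity by
    dominated convergence. *)

Set Implicit Arguments.
Unset Strict Implicit.
Unset Printing Implicit Defensive.

Import Order.TTheory GRing.Theory Num.Theory.
Import numFieldNormedType.Exports.

Local Open Scope classical_set_scope.
Local Open Scope ring_scope.

Local Notation Re := complex.Re.
Local Notation Im := complex.Im.

(** * Partitions into k-th powers *)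

(** Number of partitions of [n] into the parts 1^k, ..., M^k; the summation index is the
    multiplicity of the largest part. *)
Fixpoint pcount (k M n : nat) : nat :=
  if M is M'.+1 then
    (\sum_(0 <= l < n.+1)
       if l * M'.+1 ^ k <= n then pcount k M' (n - l * M'.+1 ^ k) else 0)%N
  else (n == 0)%N.

Lemma sum_multiples_widen (f : nat -> nat) (m n B : nat) :
  (0 < m)%N -> (n <= B)%N ->
  (\sum_(0 <= l < B.+1) (if l * m <= n then f (n - l * m) else 0) =
   \sum_(0 <= l < n.+1) (if l * m <= n then f (n - l * m) else 0))%N.
Proof.
move=> m0 nB; rewrite (big_cat_nat (n := n.+1)) //=.
rewrite [X in (_ + X)%N]big_nat_cond [X in (_ + X)%N]big1 ?addn0 // => l.
rewrite andbT => /andP[nl _]; rewrite leqNgt (leq_trans nl) //.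
by rewrite leq_pmulr.
Qed.

(** Either the largest part does not occur, or one copy of it can be removed.
    All generating function identities below are instances of this recursion. *)
Lemma pcountS k M n : pcount k M.+1 n =
  (pcount k M n +
   if M.+1 ^ k <= n then pcount k M.+1 (n - M.+1 ^ k) else 0)%N.
Proof.
have m0 : (0 < M.+1 ^ k)%N by rewrite expn_gt0.
rewrite [LHS]/= big_nat_recl // mul0n leq0n subn0; congr addn.
case: ifPn => [mn|]; last first.
  rewrite -ltnNge => nm; rewrite big1 // => l _.
  by rewrite leqNgt (leq_trans nm) // mulSn leq_addr.
rewrite /= -(@sum_multiples_widen _ _ _ n.-1) //; last first.
  by move: m0 mn; lia.
rewrite prednK; last by rewrite (leq_trans m0).
by apply: eq_bigr => l _; rewrite mulSn subnDA leq_subRL.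
Qed.

Lemma leq_pcountS k M n : (pcount k M n <= pcount k M.+1 n)%N.
Proof. by rewrite pcountS leq_addr. Qed.

Lemma leq_pcount k n : {homo pcount k ^~ n : M M' / (M <= M')%N}.
Proof. by apply: homo_leq => [//|//|M]; [exact: leq_trans|exact: leq_pcountS]. Qed.

(** Truncating each geometric factor at [B] is harmless for the coefficients
    up to [B], because every part is positive. *)
Lemma coef_prod_geom k M B n : (n <= B)%N ->
  (\prod_(i < M) \sum_(l < B.+1) 'X^(l * i.+1 ^ k) : {poly int})`_n =
  (pcount k M n)%:R.
Proof.
elim: M n => [|M IH] n nB; first by rewrite big_ord0 coef1.
have m0 : (0 < M.+1 ^ k)%N by rewrite expn_gt0.
rewrite big_ord_recr /= -(sum_multiples_widen (pcount k M) m0 nB).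
rewrite mulr_sumr coef_sum natr_sum big_mkord; apply: eq_bigr => l _.
rewrite coefMXn ltnNge; case: (leqP (l * M.+1 ^ k) n) => //= ln.
by rewrite IH // (leq_trans (leq_subr _ _)).
Qed.

(** Expanding the product of truncated geometric sums yields one monomial for
    each choice of multiplicities. *)
Lemma power_partitionsE k n : power_partitions k n = pcount k n n.
Proof.
apply/eqP; rewrite -(@eqr_nat int) -(coef_prod_geom k n (leqnn n)).
rewrite bigA_distr_bigA /= coef_sum /power_partitions -sum1_card.
rewrite natr_sum big_mkcond /=; apply/eqP; apply: eq_bigr => f _.
rewrite -expr_sum coefXn eq_sym.
(* membership in a set comprehension is the truth value of a proposition *)
by rewrite -[X in if X then _ else _]/(asbool (is_true _)) asboolb; case: eqP.
Qed.

Lemma pcount_stable k M n : (1 <= k)%N -> (n <= M)%N ->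
  pcount k M n = power_partitions k n.
Proof.
move=> k1; rewrite power_partitionsE.
elim: M => [|M IH]; first by rewrite leqn0 => /eqP ->.
rewrite leq_eqVlt => /predU1P[-> //|nM]; rewrite pcountS IH // leqNgt.
by rewrite (leq_trans nM) ?addn0 // -{1}(expn1 M.+1) leq_pexp2l.
Qed.

Lemma leq_pcount_power k M n : (1 <= k)%N -> (pcount k M n <= power_partitions k n)%N.
Proof.
move=> k1; rewrite -(@pcount_stable k (maxn M n)) ?leq_maxr //.
exact/leq_pcount/leq_maxl.
Qed.

Lemma pcount1 k n : pcount k 1 n = 1%N.
Proof.
elim: n => [|n IH]; rewrite pcountS exp1n //.
by rewrite ltn0Sn subn1 [n.+1.-1]/= IH.
Qed.

Lemma power_partitions_gt0 k n : (1 <= k)%N -> (0 < power_partitions k n)%N.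
Proof.
by move=> k1; rewrite (leq_trans _ (leq_pcount_power 1 n k1)) // pcount1.
Qed.

Lemma power_partitions0 k : power_partitions k 0 = 1%N.
Proof. by rewrite power_partitionsE. Qed.

Arguments pcount : simpl never.

(** * Complex limits and series *)

Definition cvgC (R : realType) (f : nat -> R[i]) (l : R[i]) : Prop :=
  (f : nat -> R[i]^o) @ \oo --> (l : R[i]^o).

Section ComplexLimits.
Context (R : realType).
Implicit Types (f g : nat -> R[i]) (l z : R[i]).

Lemma normc_sqr z : Normc.normc z ^+ 2 = Re z ^+ 2 + Im z ^+ 2.
Proof.
by case: z => a b /=; rewrite sqr_sqrtr // addr_ge0 ?sqr_ge0.
Qed.

Lemma normc_ge0 z : 0 <= Normc.normc z.
Proof. by case: z => a b /=; exact: sqrtr_ge0. Qed.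

Lemma ler_Re_normc z : `|Re z| <= Normc.normc z.
Proof.
rewrite -(ler_pXn2r (n := 2)) ?nnegrE ?normc_ge0 //.
by rewrite normc_sqr real_normK ?num_real // lerDl sqr_ge0.
Qed.

Lemma ler_Im_normc z : `|Im z| <= Normc.normc z.
Proof.
rewrite -(ler_pXn2r (n := 2)) ?nnegrE ?normc_ge0 //.
by rewrite normc_sqr real_normK ?num_real // lerDr sqr_ge0.
Qed.

Lemma normc_le_ReIm z : Normc.normc z <= `|Re z| + `|Im z|.
Proof.
rewrite -(ler_pXn2r (n := 2)) ?nnegrE ?normc_ge0 ?addr_ge0 //.
rewrite normc_sqr sqrrD !real_normK ?num_real // -addrA lerD2l lerDr.
by rewrite mulrn_wge0 ?mulr_ge0.
Qed.

Lemma normCE z : `|z| = (Normc.normc z)%:C%C.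
Proof. by case: z. Qed.

Lemma cvgC_ReIm f l : cvgC f l <->
  ((fun n => Re (f n)) @ \oo --> Re l) /\ ((fun n => Im (f n)) @ \oo --> Im l).
Proof.
split=> [fl|[fr fi]].
  split; apply/cvgrPdist_le => e e0;
    move/cvgrPdist_le: fl => /(_ (e%:C)%C); rewrite ltcR => /(_ e0);
    apply: filterS => n; rewrite normCE lecR; apply: le_trans.
  - by rewrite -raddfB; exact: ler_Re_normc.
  - by rewrite -raddfB; exact: ler_Im_normc.
apply/cvgrPdist_le => e; rewrite ltcE => /andP[/eqP /= e2 e0].
have {}e0 : 0 < Re e / 2 by rewrite divr_gt0.
move/cvgrPdist_le: fr => /(_ _ e0) fr; move/cvgrPdist_le: fi => /(_ _ e0) fi.
near=> n; rewrite normCE lecE /= e2 eqxx /=.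
rewrite (le_trans (normc_le_ReIm _)) // [leRHS]splitr !raddfB lerD //.
- by near: n.
- by near: n.
Unshelve. all: by end_near. Qed.

Lemma cvgC_Re f l : cvgC f l -> (fun n => Re (f n)) @ \oo --> Re l.
Proof. by case/cvgC_ReIm. Qed.

Lemma cvgC_real (u : nat -> R) (a : R) :
  u @ \oo --> a -> cvgC (fun n => (u n)%:C%C) a%:C%C.
Proof. by move=> ua; apply/cvgC_ReIm; split => //=; exact: cvg_cst. Qed.

Lemma cvgC_normc f l :
  cvgC f l -> (fun n => Normc.normc (f n)) @ \oo --> Normc.normc l.
Proof.
move=> /cvg_norm fl.
have -> : Normc.normc l = Re `|l| by rewrite normCE.
have -> : (fun n => Normc.normc (f n)) = (fun n => Re `|f n|).
  by apply/funext => n; rewrite normCE.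
exact: (cvgC_Re (f := fun n => `|f n|)).
Qed.

Lemma normc_lim_le f l (b : R) :
  cvgC f l -> (forall n, Normc.normc (f n) <= b) -> Normc.normc l <= b.
Proof.
move=> /cvgC_normc fl fb; apply: cvgr_to_le fl _.
by near=> n; exact: fb.
Unshelve. all: by end_near. Qed.

Lemma cvgC_uniq f l1 l2 : cvgC f l1 -> cvgC f l2 -> l1 = l2.
Proof. exact: (@cvg_unique _ (@norm_hausdorff R[i] R[i]^o)). Qed.

Lemma normc_prod I (r : seq I) (P : pred I) (F : I -> R[i]) :
  Normc.normc (\prod_(i <- r | P i) F i) =
  \prod_(i <- r | P i) Normc.normc (F i).
Proof.
elim/big_rec2: _ => [|i x y _ <-]; last by rewrite Normc.normcM.
exact: Normc.normc1.
Qed.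

Lemma normcX z n : Normc.normc (z ^+ n) = Normc.normc z ^+ n.
Proof.
by elim: n => [|n IH]; rewrite ?expr0 ?Normc.normc1 // !exprS Normc.normcM IH.
Qed.

Lemma normc_real (a : R) : Normc.normc a%:C%C = `|a|.
Proof. by rewrite /= expr0n addr0 sqrtr_sqr. Qed.

End ComplexLimits.

Section SeriesTools.

Lemma series_shiftE (V : zmodType) (m : nat) (c : nat -> V) n :
  series (fun i => if (m <= i)%N then c (i - m)%N else 0) (n + m)%N = series c n.
Proof.
rewrite /series /= (big_cat_nat (n := m)) //= ?leq_addl //.
rewrite big_nat_cond big1 ?add0r; last first.
  by move=> i; rewrite andbT => /andP[_ im]; rewrite leqNgt im.
rewrite -[X in \sum_(X <= _ < _) _]add0n big_addn addnK.
by apply: eq_bigr => i _; rewrite leq_addl addnK.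
Qed.

Lemma cvg_series_shift (K : numFieldType) (m : nat) (c : nat -> K) (l : K) :
  (series c : nat -> K^o) @ \oo --> (l : K^o) ->
  (series (fun n => if (m <= n)%N then c (n - m)%N else 0) : nat -> K^o) @ \oo
    --> (l : K^o).
Proof.
move=> cl; rewrite -(cvg_shiftn m) /=.
suff -> : (fun n => series (fun n => if (m <= n)%N then c (n - m)%N else 0)
  (n + m)%N) = series c by [].
by apply/funext => n; exact: series_shiftE.
Qed.

Context (R : realType).

Lemma cvg_series_dominated (b c : nat -> R) :
  (forall n, `|c n| <= b n) -> cvgn (series b) -> cvgn (series c).
Proof.
move=> cb cvb; apply: normed_cvg; apply: series_le_cvg cvb => n.
- exact: normr_ge0.
- exact: le_trans (normr_ge0 _) (cb n).
- exact: cb.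
Qed.

(** Tannery's theorem when each coefficient is eventually constant: the two
    sums differ by at most twice the tail of the dominating series. *)
Lemma tannery (b c : nat -> R) (cM : nat -> nat -> R) (l : R) (lM : nat -> R) :
  cvgn (series b) -> (forall n, `|c n| <= b n) ->
  (forall M n, `|cM M n| <= b n) ->
  (forall M n, (n <= M)%N -> cM M n = c n) ->
  series c @ \oo --> l -> (forall M, series (cM M) @ \oo --> lM M) ->
  lM @ \oo --> l.
Proof.
move=> cvb cb cMb cMc cl cMl.
pose T M := 2 * (limn (series b) - series b M).
have lT M : `|l - lM M| <= T M.
  have d : (fun K => `|series c K - series (cM M) K|) @ \oo --> `|l - lM M|.
    by apply: cvg_norm; apply: cvgB.
  apply: (cvgr_to_le d); near=> K.
  have MK : (M <= K)%N by near: K; exists M.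
  have -> : series c K - series (cM M) K =
      \sum_(M <= n < K) (c n - cM M n).
    rewrite /series /= -sumrB (big_cat_nat (n := M)) //= big_nat_cond big1 ?add0r //.
    by move=> i; rewrite andbT => /andP[_ iM]; rewrite cMc ?subrr // ltnW.
  rewrite (le_trans (ler_norm_sum _ _ _)) //.
  have -> : T M = 2 * (limn (series b) - series b K) +
      \sum_(M <= n < K) (b n + b n).
    by rewrite /T big_split /= -(sub_series_geq b MK); ring.
  rewrite ler_wpDl //.
    rewrite mulr_ge0 // subr_ge0; apply: nondecreasing_cvgn_le => //.
    by apply: nondecreasing_series => n _ _; exact: le_trans (normr_ge0 _) (cb n).
  apply: ler_sum => n _; rewrite (le_trans (ler_normB _ _)) //.
  by rewrite lerD.
have T0 : T @ \oo --> 0.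
  rewrite /T -[X in _ --> X](mulr0 2) -(subrr (limn (series b))).
  apply: cvgMl_tmp; apply: cvgB => //; exact: cvg_cst.
apply/cvgrPdist_le => e e0; move/cvgrPdist_le: T0 => /(_ _ e0).
apply: filterS => M; rewrite sub0r normrN => H; apply: le_trans (lT M) _.
exact: le_trans (ler_norm _) H.
Unshelve. all: by end_near. Qed.

Lemma cvgC_seriesP (c : nat -> R[i]) (l : R[i]) :
  cvgC (series c) l <->
  (series (fun n => Re (c n)) @ \oo --> Re l) /\
  (series (fun n => Im (c n)) @ \oo --> Im l).
Proof.
have eR : (fun n => Re (series c n)) = series (fun n => Re (c n)).
  by apply/funext => n; rewrite /series /= raddf_sum.
have eI : (fun n => Im (series c n)) = series (fun n => Im (c n)).
  by apply/funext => n; rewrite /series /= raddf_sum.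
by rewrite -eR -eI; exact: cvgC_ReIm.
Qed.

Lemma cvgC_series_dominated (b : nat -> R) (c : nat -> R[i]) :
  (forall n, Normc.normc (c n) <= b n) -> cvgn (series b) ->
  exists l, cvgC (series c) l.
Proof.
move=> cb cvb.
exists (limn (series (fun n => Re (c n))) +i*
        limn (series (fun n => Im (c n))))%C.
apply/cvgC_seriesP; split; apply: cvg_series_dominated cvb => n.
  exact: le_trans (ler_Re_normc _) (cb n).
exact: le_trans (ler_Im_normc _) (cb n).
Qed.

Lemma tanneryC (b : nat -> R) (c : nat -> R[i]) (cM : nat -> nat -> R[i])
    (l : R[i]) (lM : nat -> R[i]) :
  cvgn (series b) -> (forall n, Normc.normc (c n) <= b n) ->
  (forall M n, Normc.normc (cM M n) <= b n) ->
  (forall M n, (n <= M)%N -> cM M n = c n) ->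
  cvgC (series c) l -> (forall M, cvgC (series (cM M)) (lM M)) ->
  cvgC lM l.
Proof.
move=> cvb cb cMb cMc /cvgC_seriesP[cR cI] cMl; apply/cvgC_ReIm; split.
- apply: (tannery (b := b) (c := fun n => Re (c n))
    (cM := fun M n => Re (cM M n))) => //.
  + by move=> n; exact: le_trans (ler_Re_normc _) (cb n).
  + by move=> M n; exact: le_trans (ler_Re_normc _) (cMb M n).
  + by move=> M n nM; rewrite cMc.
  + by move=> M; case/cvgC_seriesP: (cMl M).
- apply: (tannery (b := b) (c := fun n => Im (c n))
    (cM := fun M n => Im (cM M n))) => //.
  + by move=> n; exact: le_trans (ler_Im_normc _) (cb n).
  + by move=> M n; exact: le_trans (ler_Im_normc _) (cMb M n).
  + by move=> M n nM; rewrite cMc.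
  + by move=> M; case/cvgC_seriesP: (cMl M).
Qed.

End SeriesTools.

(** * Convergence of the generating function *)

Section GeneratingFunction.
Context (R : realType) (k : nat).
Implicit Types (t : R) (M n : nat).

Lemma ler_series_shift (m : nat) (c : nat -> R) n : (forall i, 0 <= c i) ->
  series (fun i => if (m <= i)%N then c (i - m)%N else 0) n <= series c n.
Proof.
move=> c0; rewrite -(series_shiftE m c n).
apply: nondecreasing_series; last exact: leq_addr.
by move=> i _ _; case: ifP.
Qed.

Lemma pcountS_term (K : comPzRingType) (z : K) M n :
  (pcount k M.+1 n)%:R * z ^+ n = (pcount k M n)%:R * z ^+ n +
  z ^+ (M.+1 ^ k) * (if (M.+1 ^ k <= n)%N then
    (pcount k M.+1 (n - M.+1 ^ k))%:R * z ^+ (n - M.+1 ^ k) else 0).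
Proof.
rewrite pcountS natrD mulrDl; congr (_ + _); case: ifPn => [mn|_].
  by rewrite mulrCA -exprD subnKC.
by rewrite mul0r mulr0.
Qed.

Lemma expr_part_lt1 t i : 0 <= t < 1 -> 0 <= t ^+ (i.+1 ^ k) < 1.
Proof.
by move=> /andP[t0 t1]; rewrite exprn_ge0 // exprn_ilt1 // expn_eq0.
Qed.

Lemma subr_part_gt0 t i : 0 <= t < 1 -> 0 < 1 - t ^+ (i.+1 ^ k).
Proof. by move=> /(expr_part_lt1 i)/andP[_]; rewrite subr_gt0. Qed.

(** By [pcountS] the partial sums S_M satisfy S_(M+1) <= S_M + q S_(M+1), where
    q is the weight of the new part. *)
Lemma series_pcount_le t M K : 0 <= t < 1 ->
  series (fun n => (pcount k M n)%:R * t ^+ n) K <=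
  \prod_(i < M) (1 - t ^+ (i.+1 ^ k))^-1.
Proof.
move=> t01; have /andP[t0 _] := t01.
elim: M => [|M IH].
  rewrite big_ord0; case: K => [|K]; first by rewrite /series /= big_geq.
  by rewrite /series /= big_nat_recl // mul1r expr0 big1 ?addr0 // => i _; rewrite mul0r.
rewrite big_ord_recr /= ler_pdivlMr ?subr_part_gt0 // mulrBr mulr1.
apply: le_trans IH; rewrite lerBlDr.
rewrite [X in X <= _](eq_bigr _ (fun n _ => pcountS_term t M n)).
rewrite big_split /= lerD2l -mulr_sumr [leRHS]mulrC.
rewrite ler_wpM2l ?exprn_ge0 //; apply: ler_series_shift => i.
by rewrite mulr_ge0 ?exprn_ge0.
Qed.

Lemma geometric_sum_le t n : 0 <= t < 1 -> \sum_(i < n) t ^+ i <= (1 - t)^-1.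
Proof.
move=> /andP[t0 t1]; have t10 : 0 < 1 - t by rewrite subr_gt0.
rewrite -[leRHS]mul1r ler_pdivlMr // mulrC.
have := subrX1 t n; rewrite -opprB -[t - 1]opprB mulNr => /oppr_inj <-.
by rewrite gerBl exprn_ge0.
Qed.

(** (1 - q)^-1 = 1 + q / (1 - q) is at most exp (q / (1 - t)), and the weights q
    are dominated by a geometric progression: the partial products are bounded
    uniformly in the number of parts. *)
Lemma prod_geom_le t M : (1 <= k)%N -> 0 <= t < 1 ->
  \prod_(i < M) (1 - t ^+ (i.+1 ^ k))^-1 <= expR ((1 - t)^-1 ^+ 2).
Proof.
move=> k1 t01; have /andP[t0 t1] := t01.
have t10 : 0 < 1 - t by rewrite subr_gt0.
apply: le_trans (_ : expR (\sum_(i < M) t ^+ i / (1 - t)) <= _); last first.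
  rewrite ler_expR -mulr_suml expr2 ler_wpM2r ?geometric_sum_le //.
  by rewrite invr_ge0 ltW.
rewrite expR_sum; apply: ler_prod => i _.
have q0 := subr_part_gt0 i t01; have /andP[p0 _] := expr_part_lt1 i t01.
rewrite invr_ge0 ltW //=; apply: le_trans (expR_ge1Dx _).
have qt : t ^+ (i.+1 ^ k) <= t ^+ i.
  apply: ler_wiXn2l => //; first exact: ltW.
  by rewrite ltnW // -{1}[i.+1]expn1 leq_pexp2l.
have -> : (1 - t ^+ (i.+1 ^ k))^-1 =
    1 + t ^+ (i.+1 ^ k) / (1 - t ^+ (i.+1 ^ k)).
  by rewrite -{2}[1](@divff _ (1 - t ^+ (i.+1 ^ k))) ?gt_eqF // -mulrDl subrK mul1r.
rewrite lerD2l ler_pM ?invr_ge0 ?(ltW q0) //.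
rewrite lef_pV2 ?posrE // lerD2l lerN2 -[leRHS]expr1 ler_wiXn2l ?expn_gt0 //.
exact: ltW.
Qed.

Lemma is_cvg_pseries_Pcoef t : (1 <= k)%N -> 0 <= t < 1 ->
  cvgn (pseries (Pcoef R k) t).
Proof.
move=> k1 t01; have /andP[t0 t1] := t01.
apply: nondecreasing_is_cvgn.
  by apply: nondecreasing_series => n _ _; rewrite mulr_ge0 ?exprn_ge0 // /Pcoef.
exists (expR ((1 - t)^-1 ^+ 2)) => _ [K _ <-].
apply: le_trans (prod_geom_le K k1 t01); apply: le_trans (series_pcount_le K K t01).
rewrite /pseries /series /= !big_nat ler_sum // => n /andP[_ nK].
by rewrite pcount_stable // ltnW.
Qed.

Lemma natr_expr_le t n : 0 <= t < 1 -> n.+1%:R * t ^+ n <= (1 - t)^-1.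
Proof.
move=> t01; apply: le_trans (geometric_sum_le n.+1 t01).
have /andP[t0 t1] := t01.
rewrite mulr_natl -[X in _ *+ X]card_ord -sumr_const.
by apply: ler_sum => i _; rewrite ler_wiXn2l ?(ltW t1) // -ltnS.
Qed.

Lemma is_cvg_moment2 t : (1 <= k)%N -> 0 <= t < 1 ->
  cvgn (series (fun n => n.+1%:R ^+ 2 * Pcoef R k n * t ^+ n)).
Proof.
move=> k1 t01; have /andP[t0 t1] := t01.
(* with t = y^4, two factors y^n absorb the polynomial weight and y^2 < 1 is
   still a point of convergence *)
pose y := Num.sqrt (Num.sqrt t).
have y0 : 0 <= y by exact: sqrtr_ge0.
have yt : t = (y ^+ 2) ^+ 2 by rewrite !sqr_sqrtr ?sqrtr_ge0.
have y1 : y < 1.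
  by move: t1; rewrite yt -exprM -[X in _ < X](expr1n _ 4) ltr_pXn2r ?nnegrE.
have y201 : 0 <= y ^+ 2 < 1 by rewrite exprn_ge0 // exprn_ilt1.
apply: (@series_le_cvg _ _ (fun n => (1 - y)^-1 ^+ 2 * (Pcoef R k n * (y ^+ 2) ^+ n))).
- by move=> n; rewrite !mulr_ge0 ?exprn_ge0 // /Pcoef.
- by move=> n; rewrite !mulr_ge0 ?exprn_ge0 ?invr_ge0 ?subr_ge0 ?(ltW y1) // /Pcoef.
- move=> n; rewrite {1}yt.
  have H : n.+1%:R * y ^+ n <= (1 - y)^-1 by apply: natr_expr_le; rewrite y0.
  have -> : n.+1%:R ^+ 2 * Pcoef R k n * ((y ^+ 2) ^+ 2) ^+ n =
      (n.+1%:R * y ^+ n) ^+ 2 * (Pcoef R k n * (y ^+ 2) ^+ n).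
    by rewrite ![(_ ^+ 2) ^+ n]exprAC; ring.
  rewrite ler_wpM2r ?mulr_ge0 ?exprn_ge0 // /Pcoef //.
  by rewrite ler_pXn2r ?nnegrE ?mulr_ge0 ?exprn_ge0 ?invr_ge0 ?subr_ge0 // ltW.
- apply: (@is_cvg_seriesZ _ (fun n => Pcoef R k n * (y ^+ 2) ^+ n)).
  exact: is_cvg_pseries_Pcoef.
Qed.

End GeneratingFunction.

(** * Mean and variance as sums over the parts *)

(** With m = (i + 1)^k, the mean of a geometric variable G_i with
    P(G_i = l) = (1 - t^m) t^(m l), the multiplicity of the part m. *)
Definition geom_mean (R : realType) (k : nat) (t : R) (i : nat) : R :=
  t ^+ (i.+1 ^ k) / (1 - t ^+ (i.+1 ^ k)).

(** Mean and variance of the sum of (i + 1)^k G_i over i < M, for independent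
    G_i. *)
Definition partial_mean (R : realType) (k : nat) (t : R) (M : nat) : R :=
  \sum_(i < M) (i.+1 ^ k)%:R * geom_mean k t i.

Definition partial_var (R : realType) (k : nat) (t : R) (M : nat) : R :=
  \sum_(i < M) (i.+1 ^ k)%:R ^+ 2 * (geom_mean k t i * (1 + geom_mean k t i)).

Section Moments.
Context (R : realType) (k : nat) (t : R).
Hypotheses (k1 : (1 <= k)%N) (t01 : 0 <= t < 1).

Let t0 : 0 <= t. Proof. by case/andP: t01. Qed.

Lemma cvg_pcount_moment r M : (r <= 2)%N ->
  cvgn (series (fun n => n%:R ^+ r * ((pcount k M n)%:R * t ^+ n))).
Proof.
move=> r2; apply: cvg_series_dominated (is_cvg_moment2 k1 t01) => n.
rewrite ger0_norm ?mulr_ge0 ?exprn_ge0 // -mulrA ler_pM ?mulr_ge0 ?exprn_ge0 //.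
  apply: (@le_trans _ _ (n.+1%:R ^+ r)).
    by rewrite lerXn2r ?nnegrE // ler_nat.
  by rewrite ler_weXn2l // ler1n.
by rewrite ler_wpM2r ?exprn_ge0 // /Pcoef ler_nat leq_pcount_power.
Qed.

(** Multiplying [pcountS] by n^r t^n and summing gives, for r = 0, 1, 2, a linear
    equation for each power sum with M + 1 parts in terms of those with M parts;
    the old and new sums are related as the moments of a random variable and of
    its sum with an independent geometric one. *)
Lemma pcount_moments M :
  let G := \prod_(i < M) (1 - t ^+ (i.+1 ^ k))^-1 in
  let mu := partial_mean k t M in
  [/\ series (fun n => n%:R ^+ 0 * ((pcount k M n)%:R * t ^+ n)) @ \oo --> G,
      series (fun n => n%:R ^+ 1 * ((pcount k M n)%:R * t ^+ n)) @ \oo --> G * mu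
    & series (fun n => n%:R ^+ 2 * ((pcount k M n)%:R * t ^+ n)) @ \oo -->
      G * (partial_var k t M + mu ^+ 2)].
Proof.
elim: M => [|M [IH0 IH1 IH2]].
  have e r : series (fun n => n%:R ^+ r * ((pcount k 0 n)%:R * t ^+ n)) @ \oo
      --> (0 ^+ r : R).
    rewrite -cvg_shiftS /=; apply: cvg_near_cst; near=> n.
    rewrite /series /= big_nat_recl // expr0 [X in _ + X]big1 => [|i _].
      by rewrite addr0 mulr1 mulr1.
    by rewrite mul0r mulr0.
  rewrite /partial_mean /partial_var !big_ord0 expr0n /= addr0 !mulr0.
  split; first by have := e 0%N; rewrite expr0.
    by have := e 1%N; rewrite expr1.
  by have := e 2%N; rewrite expr0n.
have q10 := subr_part_gt0 k M t01.
set q := t ^+ (M.+1 ^ k) in q10 *.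
pose m : R := (M.+1 ^ k)%:R.
have [c0 [c1 [c2 [C0 C1 C2]]]] : exists c0, exists c1 c2,
    [/\ series (fun n => n%:R ^+ 0 * ((pcount k M.+1 n)%:R * t ^+ n)) @ \oo --> (c0 : R),
      series (fun n => n%:R ^+ 1 * ((pcount k M.+1 n)%:R * t ^+ n)) @ \oo --> (c1 : R)
    & series (fun n => n%:R ^+ 2 * ((pcount k M.+1 n)%:R * t ^+ n)) @ \oo --> (c2 : R)].
  by do 3 eexists; split; apply: cvg_pcount_moment.
have lin2 (a b : nat -> R) (la lb x : R) : series a @ \oo --> la ->
    series b @ \oo --> lb ->
    series (fun n => a n + x * b n) @ \oo --> la + x * lb.
  move=> ca cb; have -> : series (fun n => a n + x * b n) =
      series a + x *: series b by rewrite -seriesZ -seriesD.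
  by apply: cvgD => //; apply: cvgZl_tmp.
have rec r (b : nat -> R) (l lb l' : R) :
    series (fun n => n%:R ^+ r * ((pcount k M n)%:R * t ^+ n)) @ \oo --> l ->
    series b @ \oo --> lb ->
    (forall n, b n = (n + M.+1 ^ k)%:R ^+ r * ((pcount k M.+1 n)%:R * t ^+ n)) ->
    series (fun n => n%:R ^+ r * ((pcount k M.+1 n)%:R * t ^+ n)) @ \oo --> l' ->
    l' = l + q * lb.
  move=> cl cb eb cl'.
  have H := lin2 _ _ _ _ q cl (cvg_series_shift (K := R) (M.+1 ^ k) cb).
  apply: (cvg_unique _ cl' _) => //; move: H.
  set u := fun n => _ + _; suff -> : u = fun n =>
    n%:R ^+ r * ((pcount k M.+1 n)%:R * t ^+ n) by [].
  apply/funext => n; rewrite /u [in RHS]pcountS_term mulrDr -/q.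
  congr (_ + _); rewrite mulrCA; congr (_ * _).
  by case: ifPn => mn; rewrite ?mulr0 // eb subnK.
have E0 := rec 0%N _ _ _ _ IH0 C0 (fun n => erefl) C0.
have E1 := rec 1%N _ _ _ _ IH1 (lin2 _ _ _ _ m C1 C0) _ C1.
have {}E1 := E1 (fun n => ltac:(rewrite natrD !expr1 expr0; ring)).
have E2 := rec 2%N _ _ _ _ IH2
  (lin2 _ _ _ _ (m ^+ 2) (lin2 _ _ _ _ (2 * m) C2 C1) C0) _ C2.
have {}E2 := E2 (fun n => ltac:(rewrite natrD !expr1 expr0; ring)).
rewrite /partial_mean /partial_var !big_ord_recr /= -/(partial_mean k t M).
rewrite -/(partial_var k t M) /geom_mean -/q -/m.
set G := \prod_(i < M) _ in IH0 IH1 IH2 E0 E1 E2 *.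
set mu := partial_mean k t M in IH1 IH2 E1 E2 *.
set V := partial_var k t M in IH2 E2 *.
have q1 : 1 - q != 0 by rewrite gt_eqF.
have D0 : c0 = G / (1 - q).
  by apply: (mulIf q1); rewrite divfK // mulrBr mulr1 [X in X - _]E0; ring.
have D1 : c1 = (G * mu + q * m * c0) / (1 - q).
  by apply: (mulIf q1); rewrite divfK // mulrBr mulr1 [X in X - _]E1; ring.
have D2 : c2 = (G * (V + mu ^+ 2) + q * (2 * m * c1 + m ^+ 2 * c0)) / (1 - q).
  by apply: (mulIf q1); rewrite divfK // mulrBr mulr1 [X in X - _]E2; ring.
split.
- by rewrite -D0.
- suff <- : c1 = G / (1 - q) * (mu + m * (q / (1 - q))) by [].
  by rewrite D1 D0; field.
- suff <- : c2 = G / (1 - q) * (V + m ^+ 2 * (q / (1 - q) * (1 + q / (1 - q))) +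
    (mu + m * (q / (1 - q))) ^+ 2) by [].
  by rewrite D2 D1 D0; field.
Unshelve. all: by end_near. Qed.

(** All moments of order at most 2 pass to the limit M -> oo by [tannery], since
    the n-th coefficient is constant from M = n on. *)
Lemma Pcoef_moments : exists f e1 e2 : R,
  [/\ 0 < f,
     [/\ series (fun n => Pcoef R k n * t ^+ n) @ \oo --> f,
      series (fun n => n%:R * (Pcoef R k n * t ^+ n)) @ \oo --> e1
    & series (fun n => n%:R ^+ 2 * (Pcoef R k n * t ^+ n)) @ \oo --> e2],
    (fun M => \prod_(i < M) (1 - t ^+ (i.+1 ^ k))^-1) @ \oo --> f,
    partial_mean k t @ \oo --> e1 / f
    & partial_var k t @ \oo --> e2 / f - (e1 / f) ^+ 2].
Proof.
have cv r : (r <= 2)%N ->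
    cvgn (series (fun n => n%:R ^+ r * (Pcoef R k n * t ^+ n))).
  move=> r2; apply: cvg_series_dominated (is_cvg_moment2 k1 t01) => n.
  rewrite ger0_norm ?mulr_ge0 ?exprn_ge0 // /Pcoef // -mulrA.
  rewrite ler_wpM2r ?mulr_ge0 ?exprn_ge0 //.
  apply: (@le_trans _ _ (n.+1%:R ^+ r)).
    by rewrite lerXn2r ?nnegrE // ler_nat.
  by rewrite ler_weXn2l // ler1n.
pose e r := limn (series (fun n => n%:R ^+ r * (Pcoef R k n * t ^+ n))).
have tan r lM : (r <= 2)%N -> (forall M,
    series (fun n => n%:R ^+ r * ((pcount k M n)%:R * t ^+ n)) @ \oo --> lM M) ->
    lM @ \oo --> e r.
  move=> r2; apply: (tannery (b := fun n => n%:R ^+ r * (Pcoef R k n * t ^+ n))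
     (c := fun n => n%:R ^+ r * (Pcoef R k n * t ^+ n))) => //.
  - exact: cv.
  - by move=> n; rewrite ger0_norm ?mulr_ge0 ?exprn_ge0 // /Pcoef.
  - move=> M n; rewrite ger0_norm ?mulr_ge0 ?exprn_ge0 //.
    rewrite ler_wpM2l ?exprn_ge0 // ler_wpM2r ?exprn_ge0 //.
    by rewrite /Pcoef ler_nat leq_pcount_power.
  - by move=> M n nM; rewrite /Pcoef pcount_stable.
  - exact: cv.
pose G M := \prod_(i < M) (1 - t ^+ (i.+1 ^ k))^-1.
have H0 : G @ \oo --> e 0%N.
  by apply: (tan 0%N) => // M; case: (pcount_moments M).
have H1 : (fun M => G M * partial_mean k t M) @ \oo --> e 1%N.
  by apply: (tan 1%N) => // M; case: (pcount_moments M).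
have H2 : (fun M => G M * (partial_var k t M + partial_mean k t M ^+ 2)) @ \oo
    --> e 2%N.
  by apply: (tan 2%N) => // M; case: (pcount_moments M).
have G0 M : 0 < G M.
  by rewrite prodr_gt0 // => i _; rewrite invr_gt0 subr_part_gt0.
have f0 : 0 < e 0%N.
  apply: (@lt_le_trans _ _ (series (fun n => n%:R ^+ 0 * (Pcoef R k n * t ^+ n)) 1)).
    by rewrite /series /= big_nat1 !mul1r /Pcoef power_partitions0 mul1r.
  apply: nondecreasing_cvgn_le; last exact: cv.
  by apply: nondecreasing_series => n _ _; rewrite !mulr_ge0 ?exprn_ge0 // /Pcoef.
have E1 : partial_mean k t @ \oo --> e 1%N / e 0%N.
  have -> : partial_mean k t = (fun M => (G M * partial_mean k t M) / G M).
    by apply/funext => M; rewrite mulrAC divff ?mul1r ?gt_eqF.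
  by apply: cvgM => //; apply: cvgV => //; rewrite gt_eqF.
have E2 : partial_var k t @ \oo --> e 2%N / e 0%N - (e 1%N / e 0%N) ^+ 2.
  have -> : partial_var k t = (fun M =>
     (G M * (partial_var k t M + partial_mean k t M ^+ 2)) / G M -
     partial_mean k t M ^+ 2).
    by apply/funext => M; rewrite mulrAC divff ?mul1r ?gt_eqF // addrK.
  apply: cvgB; first by apply: cvgM => //; apply: cvgV => //; rewrite gt_eqF.
  by rewrite expr2; under eq_fun do rewrite expr2; apply: cvgM.
exists (e 0%N), (e 1%N), (e 2%N); split => //; split.
- have -> : (fun n => Pcoef R k n * t ^+ n) =
      (fun n => n%:R ^+ 0 * (Pcoef R k n * t ^+ n)).
    by apply/funext => n; rewrite expr0 mul1r.
  exact: (cv 0%N).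
- exact: (cv 1%N).
- exact: (cv 2%N).
Qed.

End Moments.

(** * The product formula in the unit disc *)

Section ComplexGeneratingFunction.
Context (R : realType) (k : nat).
Hypothesis k1 : (1 <= k)%N.

Section Disc.
Variables (z : R[i]).
Hypothesis z1 : Normc.normc z < 1.

Let r := Normc.normc z.
Let r01 : 0 <= r < 1. Proof. by rewrite normc_ge0. Qed.

Lemma subr_expC_neq0 m : (0 < m)%N -> 1 - z ^+ m != 0.
Proof.
move=> m0; apply/eqP => /subr0_eq /(congr1 (@Normc.normc R)).
rewrite normcX Normc.normc1 => /esym/eqP; rewrite lt_eqF //.
by rewrite exprn_ilt1 ?normc_ge0 // -lt0n.
Qed.

Lemma normc_pcount_term M n :
  Normc.normc ((pcount k M n)%:R * z ^+ n) <= Pcoef R k n * r ^+ n.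
Proof.
rewrite Normc.normcM normcX ler_wpM2r ?exprn_ge0 ?normc_ge0 //.
rewrite -(rmorph_nat (real_complex R)) normc_real ger0_norm //.
by rewrite /Pcoef ler_nat leq_pcount_power.
Qed.

(** The limit l' with one more part satisfies l' = l + q l' by [pcountS]. *)
Lemma pcount_genfunC M : cvgC (series (fun n => (pcount k M n)%:R * z ^+ n))
  (\prod_(i < M) (1 - z ^+ (i.+1 ^ k))^-1).
Proof.
elim: M => [|M IH].
  rewrite big_ord0 /cvgC -cvg_shiftS /=; apply: cvg_near_cst; near=> n.
  rewrite /series /= big_nat_recl // [X in _ + X]big1 => [|i _].
    by rewrite addr0 mulr1.
  by rewrite mul0r.
set q := z ^+ (M.+1 ^ k).
have q1 : 1 - q != 0 by rewrite subr_expC_neq0 ?expn_gt0.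
have [l' Cl'] : exists l', cvgC (series (fun n => (pcount k M.+1 n)%:R * z ^+ n)) l'.
  apply: cvgC_series_dominated (normc_pcount_term _) _.
  exact: is_cvg_pseries_Pcoef.
have E : l' = \prod_(i < M) (1 - z ^+ (i.+1 ^ k))^-1 + q * l'.
  apply: (cvgC_uniq Cl').
  have -> : (fun n => (pcount k M.+1 n)%:R * z ^+ n) =
     (fun n => (pcount k M n)%:R * z ^+ n) + q *: (fun n =>
       if (M.+1 ^ k <= n)%N then (pcount k M.+1 (n - M.+1 ^ k)%N)%:R *
         z ^+ (n - M.+1 ^ k) else 0) :> (nat -> R[i]^o).
    by apply/funext => n; rewrite pcountS_term.
  rewrite seriesD seriesZ; apply: cvgD; first exact: IH.
  by apply: cvgZl_tmp; exact: (cvg_series_shift (K := R[i]) (M.+1 ^ k) Cl').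
rewrite big_ord_recr /= -/q.
suff <- : l' = \prod_(i < M) (1 - z ^+ (i.+1 ^ k))^-1 / (1 - q) by [].
by apply: (mulIf q1); rewrite divfK // mulrBr mulr1 [X in X - _]E; ring.
Unshelve. all: by end_near. Qed.

Lemma Pcoef_genfunC : exists2 p : R[i],
  cvgC (fun M => \prod_(i < M) (1 - z ^+ (i.+1 ^ k))^-1) p &
  cvgC (series (fun n => (Pcoef R k n)%:C%C * z ^+ n)) p.
Proof.
have bd n : Normc.normc ((Pcoef R k n)%:C%C * z ^+ n) <= Pcoef R k n * r ^+ n.
  by rewrite Normc.normcM normcX normc_real ger0_norm // /Pcoef.
have cvb := is_cvg_pseries_Pcoef k1 r01.
have [p Hp] := cvgC_series_dominated bd cvb.
exists p => //; apply: (tanneryC cvb bd _ _ Hp pcount_genfunC) => //.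
  by move=> M n; exact: normc_pcount_term.
by move=> M n nM; rewrite /Pcoef pcount_stable // rmorph_nat.
Qed.

End Disc.

Lemma PprodE (z : R[i]) N :
  Pprod k z N = \prod_(i < N) (1 - z ^+ (i.+1 ^ k))^-1.
Proof. by rewrite /Pprod big_add1 big_mkord. Qed.

(** Every coefficient is at least 1, because of the part 1, so the terms do not
    tend to 0 outside the unit interval. *)
Lemma cvg_radius_Pcoef : cvg_radius (Pcoef R k) = 1%:E.
Proof.
apply/eqP; rewrite eq_le; apply/andP; split.
  apply: ge_ereal_sup => _ [x cx <-]; rewrite lee_fin leNgt; apply/negP => x1.
  have /cvgrPdist_lt/(_ _ ltr01) := cvg_series_cvg_0 cx.
  case=> N _ /(_ N (leqnn N)) /=; rewrite sub0r normrN normrM normrX.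
  rewrite ltNge => /negP; apply.
  rewrite -[leLHS]mul1r ler_pM // ?exprn_ege1 ?(ltW x1) //.
  by rewrite ger0_norm /Pcoef // ler1n power_partitions_gt0.
apply/lee_mul01Pr => // t /andP[t0 t1]; rewrite mule1.
apply: ereal_sup_ubound; exists t; last by rewrite ger0_norm ?ltW.
by apply: is_cvg_pseries_Pcoef => //; rewrite ltW.
Qed.

Lemma classK_Pcoef : classK (Pcoef R k).
Proof.
split.
- by move=> n; rewrite /Pcoef.
- by rewrite cvg_radius_Pcoef lte_fin.
- by rewrite /Pcoef ltr0n power_partitions_gt0.
- by exists 1%N => //; rewrite /Pcoef pnatr_eq0 -lt0n power_partitions_gt0.
Qed.

End ComplexGeneratingFunction.

(** * The scale of the variance *)

Section VarianceScale.
Context (R : realType) (k : nat).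
Hypothesis k1 : (1 <= k)%N.
Implicit Types (s t : R) (i j m n N : nat).

(** N is the integer part of a^(-1/k). *)
Lemma floor_root (a : R) : 0 < a ->
  exists N : nat, a * (N ^ k)%:R <= 1 /\ 1 < a * (N.+1 ^ k)%:R.
Proof.
move=> a0; pose P n := a * (n ^ k)%:R <= 1.
have P0 : exists n, P n by exists 0%N; rewrite /P exp0n // mulr0.
have bd n : P n -> (n <= Num.truncn a^-1)%N.
  rewrite /P => Pn; rewrite truncn_ge_nat ?invr_ge0 ?(ltW a0) // -[leRHS]mul1r.
  rewrite ler_pdivlMr // mulrC; apply: le_trans Pn; rewrite ler_pM2l // ler_nat.
  by case: n => // n; rewrite -{1}(expn1 n.+1) leq_pexp2l.
case: (ex_maxnP P0 bd) => N PN maxN; exists N; split => //.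
rewrite ltNge; apply/negP => /maxN; by rewrite ltnn.
Qed.

Lemma expr_subr1_ge s n : 0 <= s <= 1 -> 1 - n%:R * s <= (1 - s) ^+ n.
Proof.
move=> /andP[s0 s1]; elim: n => [|n IH]; first by rewrite mul0r subr0 expr0.
have s1' : 0 <= 1 - s by rewrite subr_ge0.
rewrite exprS; apply: le_trans (ler_wpM2l s1' IH).
have := ler0n R n; rewrite -natr1; nra.
Qed.

Lemma expr_subr1_le_expR s n : 0 <= s <= 1 -> (1 - s) ^+ n <= expR (- (n%:R * s)).
Proof.
move=> /andP[s0 s1]; rewrite -mulrN mulrC expRM_natr lerXn2r ?nnegrE ?expR_ge0 //.
  by rewrite subr_ge0.
exact: expR_ge1Dx.
Qed.

Lemma expR_ge_pow5 (x : R) : 0 <= x -> (1 + x) ^+ 5 <= 5 ^+ 5 * expR x.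
Proof.
move=> x0; have -> : expR x = expR (x / 5) ^+ 5 by rewrite -expRM_natr divfK.
have -> : 5 ^+ 5 * expR (x / 5) ^+ 5 = (5 * expR (x / 5)) ^+ 5 by rewrite exprMn; congr (_ * _); ring.
rewrite lerXn2r ?nnegrE ?addr_ge0 ?mulr_ge0 ?expR_ge0 //.
have := expR_ge1Dx (x / 5); lra.
Qed.

(** With x = m s, both 1 - q >= x / (1 + x) and q <= exp (- x) hold, and the
    exponential beats (1 + x)^5. For r = 2 and r = 3 the left-hand side is the
    contribution of the part m to the variance and to the third moments; the
    right-hand side is summable over the parts, which [sum_profile_le]
    quantifies. *)
Lemma geom_moment_le s m r : 0 < s <= 1 -> (0 < m)%N -> (r <= 3)%N ->
  let q := (1 - s) ^+ m in
  q < 1 /\ (m%:R / (1 - q)) ^+ r * q <= 5 ^+ 5 * s^-1 ^+ r * (1 + m%:R * s)^-1 ^+ 2.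
Proof.
move=> /andP[s0 s1] m0 r3 /=; set q := (1 - s) ^+ m; set x := m%:R * s.
have x0 : 0 < x by rewrite mulr_gt0 // ltr0n.
have q0 : 0 <= q by rewrite exprn_ge0 // subr_ge0.
have qe : q <= expR (- x) by apply: expr_subr1_le_expR; rewrite ltW.
have q5 : q <= 5 ^+ 5 * (1 + x)^-1 ^+ 5.
  apply: le_trans qe _; rewrite expRN exprVn -ler_pdivrMr ?invr_gt0 ?exprn_gt0 ?addr_gt0 //.
  rewrite invrK mulrC ler_pdivrMr ?expR_gt0 //; exact/expR_ge_pow5/ltW.
have qx : x / (1 + x) <= 1 - q.
  have x1 : 0 < 1 + x by rewrite addr_gt0.
  have : q <= (1 + x)^-1.
    by apply: le_trans qe _; rewrite expRN lef_pV2 ?posrE ?expR_gt0 ?expR_ge1Dx.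
  have -> : x / (1 + x) = 1 - (1 + x)^-1 by field; rewrite gt_eqF.
  by rewrite lerD2l lerN2.
have x1 : 0 < 1 + x by rewrite addr_gt0.
have q1 : 0 < 1 - q by apply: lt_le_trans qx; rewrite divr_gt0.
split; first by rewrite -subr_gt0.
have mq : m%:R / (1 - q) <= (1 + x) / s.
  rewrite ler_pdivrMr // mulrAC ler_pdivlMr // -/x.
  by rewrite -ler_pdivrMl // mulrC.
apply: (@le_trans _ _ (((1 + x) / s) ^+ r * (5 ^+ 5 * (1 + x)^-1 ^+ 5))).
  have mq0 : 0 <= m%:R / (1 - q) by rewrite divr_ge0 // ltW.
  have xs0 : 0 <= (1 + x) / s by rewrite divr_ge0 // ltW.
  apply: ler_pM => //; first exact: exprn_ge0.
  by rewrite lerXn2r ?nnegrE.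
rewrite exprMn; set y := (1 + x).
have -> : y ^+ r * s^-1 ^+ r * (5 ^+ 5 * y^-1 ^+ 5) =
    5 ^+ 5 * s^-1 ^+ r * y^-1 ^+ 2 * (y ^+ r * y^-1 ^+ 3) by ring.
have y1 : 1 <= y by rewrite lerDl ltW.
have yr : y ^+ r * y^-1 ^+ 3 <= 1.
  by rewrite exprVn ler_pdivrMr ?exprn_gt0 // mul1r ler_weXn2l.
have c0 : 0 <= 5 ^+ 5 :> R by lra.
have y0 : 0 <= y^-1 ^+ 2 by rewrite exprn_ge0 // invr_ge0 ltW.
have s0' : 0 <= s^-1 ^+ r by rewrite exprn_ge0 // invr_ge0 ltW.
by apply: ler_piMr yr; exact: mulr_ge0 (mulr_ge0 c0 s0') y0.
Qed.

Lemma leq_mulX_cross a b : (a <= b)%N -> (b * a ^ k <= b ^ k * a)%N.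
Proof.
move=> ab; case: k k1 => // k' _; rewrite !expnS mulnA -mulnA [leqRHS]mulnAC mulnA.
rewrite leq_mul2l; apply/orP; right; case: k' => [|k'] //.
by rewrite leq_exp2r.
Qed.

(** For j > N, m s = j^k s is at least (j / N)^k / 2, hence at least j / (2 N). *)
Lemma ler_profile s j N : (0 < N)%N -> 0 < s -> 1 < 2 * s * (N ^ k)%:R ->
  (N%:R + j%:R) / (3 * N%:R) <= 1 + (j ^ k)%:R * s.
Proof.
move=> N0 s0 sN; have N0' : 0 < N%:R :> R by rewrite ltr0n.
rewrite ler_pdivrMr ?mulr_gt0 //.
have [jN|Nj] := leqP j N.
  have : j%:R <= N%:R :> R by rewrite ler_nat.
  have : 0 <= (j ^ k)%:R * s by rewrite mulr_ge0 // ltW.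
  nra.
have jk := leq_mulX_cross (ltnW Nj).
have jk' : j%:R * (N ^ k)%:R <= (j ^ k)%:R * N%:R :> R by rewrite -!natrM ler_nat.
have H : j%:R <= 2 * s * ((j ^ k)%:R * N%:R).
  apply: (@le_trans _ _ (2 * s * (j%:R * (N ^ k)%:R))); last first.
    by rewrite ler_wpM2l // mulr_ge0 // ltW.
  by rewrite mulrCA ler_peMr // ltW.
have : (1 + (j ^ k)%:R * s) * (3 * N%:R) =
    3 * N%:R + (2 * s * ((j ^ k)%:R * N%:R)) * (3 / 2) by field.
move=> ->; have := ler0n R j; lra.
Qed.

(** The squares of the bounds of [ler_profile] telescope: 1 / (N + j)^2 is at most
    1 / (N + j - 1) - 1 / (N + j). *)
Lemma sum_profile_le s N n : (0 < N)%N -> 0 < s -> 1 < 2 * s * (N ^ k)%:R ->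
  \sum_(i < n) (1 + (i.+1 ^ k)%:R * s)^-1 ^+ 2 <= 9 * N%:R.
Proof.
move=> N0 s0 sN; have N0' : 0 < N%:R :> R by rewrite ltr0n.
suff H : \sum_(i < n) (1 + (i.+1 ^ k)%:R * s)^-1 ^+ 2 <=
    9 * N%:R ^+ 2 * (N%:R^-1 - (N%:R + n%:R)^-1).
  apply: le_trans H _; have : 0 <= (N%:R + n%:R : R)^-1 by rewrite invr_ge0 addr_ge0.
  have : N%:R ^+ 2 * N%:R^-1 = N%:R :> R by rewrite expr2 mulfK // gt_eqF.
  have : 0 <= N%:R ^+ 2 :> R by rewrite exprn_ge0.
  nra.
elim: n => [|n IH]; first by rewrite big_ord0 addr0 subrr mulr0.
rewrite big_ord_recr /=; apply: le_trans (lerD IH (lexx _)) _.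
rewrite -lerBrDl -mulrBr.
have a0 : 0 < N%:R + n%:R :> R by rewrite ltr_wpDr.
have -> : N%:R^-1 - (N%:R + n.+1%:R)^-1 - (N%:R^-1 - (N%:R + n%:R)^-1) =
   ((N%:R + n%:R) * (N%:R + n.+1%:R))^-1 :> R.
  by rewrite -natr1; field; rewrite !gt_eqF // addrA addr_gt0.
have a1 : 0 < N%:R + n.+1%:R :> R by rewrite ltr_wpDr.
have P := ler_profile n.+1 N0 s0 sN.
apply: (@le_trans _ _ (((N%:R + n.+1%:R) / (3 * N%:R))^-1 ^+ 2)).
  have u0 : 0 < (N%:R + n.+1%:R) / (3 * N%:R) :> R.
    by rewrite divr_gt0 ?mulr_gt0.
  have v0 : 0 < 1 + (n.+1 ^ k)%:R * s by exact: lt_le_trans P.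
  by rewrite lerXn2r ?nnegrE ?invr_ge0 ?(ltW u0) ?(ltW v0) // lef_pV2.
have -> : ((N%:R + n.+1%:R) / (3 * N%:R))^-1 ^+ 2 =
    9 * N%:R ^+ 2 * ((N%:R + n.+1%:R) * (N%:R + n.+1%:R))^-1 :> R.
  by field; rewrite !gt_eqF.
rewrite ler_wpM2l ?mulr_ge0 ?exprn_ge0 // lef_pV2 ?posrE ?mulr_gt0 //.
by rewrite ler_pM2r // lerD2l ler_nat.
Qed.

Lemma geom_varE t i : let q := t ^+ (i.+1 ^ k) in q < 1 ->
  geom_mean k t i * (1 + geom_mean k t i) = q / (1 - q) ^+ 2.
Proof.
move=> /= q1; rewrite /geom_mean; field.
by rewrite subr_eq0 gt_eqF.
Qed.

Lemma partial_var_le s N n : 0 < s <= 1 -> (0 < N)%N ->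
  1 < 2 * s * (N.+1 ^ k)%:R ->
  partial_var k (1 - s) n <= 18 * 5 ^+ 5 * N%:R / s ^+ 2.
Proof.
move=> s01 N0 sN; have /andP[s0 _] := s01.
apply: (@le_trans _ _ (5 ^+ 5 * s^-1 ^+ 2 * (9 * N.+1%:R))).
  apply: le_trans (ler_wpM2l _ (sum_profile_le n _ s0 sN)) => //; last first.
    by rewrite mulr_ge0 // exprn_ge0 // invr_ge0 ltW.
  rewrite mulr_sumr; apply: ler_sum => i _.
  have m0 : (0 < i.+1 ^ k)%N by rewrite expn_gt0.
  have [q1 H] := geom_moment_le s01 m0 (isT : (2 <= 3)%N).
  by rewrite geom_varE // mulrCA -exprVn -exprMn mulrC.
have : N.+1%:R <= 2 * N%:R :> R by rewrite -natrM ler_nat; lia.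
have : 0 <= s^-1 ^+ 2 by rewrite exprn_ge0 // invr_ge0 ltW.
by rewrite -exprVn; nra.
Qed.

(** Of the order of the sum of the third absolute central moments of the
    variables (i + 1)^k G_i. *)
Definition partial_third (t : R) (M : nat) : R :=
  \sum_(i < M) (i.+1 ^ k)%:R ^+ 3 * (geom_mean k t i * (1 + geom_mean k t i) ^+ 2).

Lemma partial_third_le s N n : 0 < s <= 1 -> (0 < N)%N ->
  1 < 2 * s * (N.+1 ^ k)%:R ->
  partial_third (1 - s) n <= 18 * 5 ^+ 5 * N%:R / s ^+ 3.
Proof.
move=> s01 N0 sN; have /andP[s0 _] := s01.
apply: (@le_trans _ _ (5 ^+ 5 * s^-1 ^+ 3 * (9 * N.+1%:R))).
  apply: le_trans (ler_wpM2l _ (sum_profile_le n _ s0 sN)) => //; last first.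
    by rewrite mulr_ge0 // exprn_ge0 // invr_ge0 ltW.
  rewrite mulr_sumr; apply: ler_sum => i _.
  have m0 : (0 < i.+1 ^ k)%N by rewrite expn_gt0.
  have [q1 H] := geom_moment_le s01 m0 (isT : (3 <= 3)%N).
  apply: le_trans H; rewrite le_eqVlt; apply/orP; left; apply/eqP.
  by rewrite /geom_mean; field; rewrite subr_eq0 gt_eqF.
have : N.+1%:R <= 2 * N%:R :> R by rewrite -natrM ler_nat; lia.
have : 0 <= s^-1 ^+ 3 by rewrite exprn_ge0 // invr_ge0 ltW.
by rewrite -exprVn; nra.
Qed.

(** A part m with m s <= 1/2 has t^m >= 1/2, so its multiplicity spreads over
    about 1 / (m s) values. *)
Lemma geom_var_ge s i N : 0 < s <= 1 -> 2 * s * (N ^ k)%:R <= 1 -> (i < N)%N ->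
  (2 * ((i.+1 ^ k)%:R * s) ^+ 2)^-1 <=
    geom_mean k (1 - s) i * (1 + geom_mean k (1 - s) i).
Proof.
move=> s01 sN iN; have /andP[s0 s1] := s01.
have m0 : (0 < i.+1 ^ k)%N by rewrite expn_gt0.
set x := (i.+1 ^ k)%:R * s.
have x0 : 0 < x by rewrite mulr_gt0 // ltr0n.
have x2 : 2 * x <= 1.
  apply: le_trans sN; rewrite mulrA mulrAC ler_pM2l ?mulr_gt0 //.
  by rewrite ler_nat leq_exp2r.
have s01' : 0 <= s <= 1 by rewrite ltW.
have qx := expr_subr1_ge (i.+1 ^ k) s01'; rewrite -/x in qx.
have q1 : (1 - s) ^+ (i.+1 ^ k) < 1.
  by apply: (proj1 (geom_moment_le s01 m0 (isT : (0 <= 3)%N))).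
rewrite geom_varE //; set q := (1 - s) ^+ _ in qx q1 *.
have q10 : 0 < 1 - q by rewrite subr_gt0.
rewrite invfM ler_pM ?invr_ge0 ?exprn_ge0 ?(ltW x0) //; first lra.
rewrite lef_pV2 ?posrE ?exprn_gt0 // lerXn2r ?nnegrE ?(ltW x0) ?(ltW q10) //; lra.
Qed.

Lemma geom_mean_ge0 t i : 0 <= t < 1 -> 0 <= geom_mean k t i.
Proof.
move=> t01; have /andP[t0 _] := t01; rewrite /geom_mean divr_ge0 ?exprn_ge0 //.
exact/ltW/subr_part_gt0.
Qed.

Lemma geom_var_ge0 t i : 0 <= t < 1 -> 0 <= geom_mean k t i * (1 + geom_mean k t i).
Proof. by move=> /(geom_mean_ge0 i) w0; rewrite mulr_ge0 ?addr_ge0. Qed.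

(** Each of the first N parts contributes at least 1 / (2 s^2). *)
Lemma partial_var_ge s N n : 0 < s <= 1 -> 2 * s * (N ^ k)%:R <= 1 -> (N <= n)%N ->
  N%:R / (2 * s ^+ 2) <= partial_var k (1 - s) n.
Proof.
move=> s01 sN Nn; have /andP[s0 s1] := s01.
have t01 : 0 <= 1 - s < 1 by rewrite subr_ge0 s1 gtrBl.
apply: (@le_trans _ _ (partial_var k (1 - s) N)); last first.
  rewrite /partial_var -!(big_mkord predT (fun i => (i.+1 ^ k)%:R ^+ 2 *
    (geom_mean k (1 - s) i * (1 + geom_mean k (1 - s) i)))).
  rewrite [leRHS](big_cat_nat (n := N)) //= lerDl sumr_ge0 // => i _.
  by rewrite mulr_ge0 ?exprn_ge0 ?geom_var_ge0.
rewrite mulr_natl -[X in _ *+ X]card_ord -sumr_const; apply: ler_sum => i _.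
have m0 : 0 < (i.+1 ^ k)%:R :> R by rewrite ltr0n expn_gt0.
rewrite -ler_pdivrMl ?exprn_gt0 //.
apply: le_trans (geom_var_ge s01 sN (ltn_ord i)).
by rewrite -invfM lef_pV2 ?posrE ?mulr_gt0 ?exprn_gt0 ?mulr_gt0 // exprMn; lra.
Qed.

End VarianceScale.

(** * Trigonometric inequalities *)

Definition expi (R : realType) (x : R) : R[i] := (cos x +i* sin x)%C.

Section Trigonometry.
Context (R : realType).
Implicit Types x y h w : R.

Lemma normc_expi x : Normc.normc (expi x) = 1.
Proof. by rewrite /= cos2Dsin2 sqrtr1. Qed.

Lemma expiD x y : expi (x + y) = expi x * expi y.
Proof.
by apply/eqP; rewrite eq_complex /= cosD sinD eqxx addrC [cos x * _]mulrC mulrC eqxx.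
Qed.

Lemma expi0 : expi 0 = 1 :> R[i].
Proof. by rewrite /expi cos0 sin0. Qed.

Lemma expiMn x n : expi (n%:R * x) = expi x ^+ n.
Proof.
elim: n => [|n IH]; first by rewrite mul0r expi0 expr0.
by rewrite -natr1 mulrDl mul1r expiD IH exprSr.
Qed.

Lemma expi_sum I (r : seq I) (P : pred I) (F : I -> R) :
  expi (\sum_(i <- r | P i) F i) = \prod_(i <- r | P i) expi (F i).
Proof. by elim/big_rec2: _ => [|i x y _ <-]; [exact: expi0|rewrite expiD]. Qed.

Lemma ler_dist_derive (f df : R -> R) (b x : R) : f 0 = 0 ->
  (forall y, is_derive y 1 f (df y)) ->
  (forall y, `|y| <= `|x| -> `|df y| <= b) -> `|f x| <= b * `|x|.
Proof.
move=> f0 fdf dfb.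
have cf : continuous f.
  by move=> y; apply/differentiable_continuous/derivable1_diffP; case: (fdf y).
have [x0|x0] := leP 0 x.
  have [c cI] := MVT_segment x0 (fun y _ => fdf y)
    (continuous_subspaceT cf).
  rewrite f0 !subr0 => ->; rewrite normrM ler_wpM2r //; apply: dfb.
  by move: cI; rewrite in_itv /= => /andP[c0 cx]; rewrite !ger0_norm.
have [c cI] := MVT_segment (ltW x0) (fun y _ => fdf y)
    (continuous_subspaceT cf).
rewrite f0 !sub0r => e; rewrite -normrN e normrM normrN ler_wpM2r //; apply: dfb.
move: cI; rewrite in_itv /= => /andP[c0 cx].
by rewrite !ler0_norm ?(ltW x0) // lerN2.
Qed.

Lemma ler_norm_sin x : `|sin x| <= `|x|.
Proof.
rewrite -[leRHS]mul1r; apply: (@ler_dist_derive sin cos) => //; first exact: sin0.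
by move=> y _; rewrite ler_norml cos_geN1 cos_le1.
Qed.

Lemma subr_cos x : 1 - cos x = 2 * sin (x / 2) ^+ 2.
Proof.
rewrite {1}[x]splitr cosD -!expr2; have := cos2Dsin2 (x / 2); lra.
Qed.

Lemma subr_cos_ge0 x : 0 <= 1 - cos x.
Proof. by rewrite subr_ge0 cos_le1. Qed.

Lemma subr_cos_le2 x : 1 - cos x <= x ^+ 2 / 2.
Proof.
rewrite subr_cos; have := ler_norm_sin (x / 2).
rewrite -(ler_pXn2r (n := 2)) ?nnegrE // !real_normK ?num_real //.
rewrite exprMn; lra.
Qed.

Lemma ler_norm_sin_sub3 x : `|sin x - x| <= `|x| ^+ 3 / 2.
Proof.
have -> : `|x| ^+ 3 / 2 = `|x| ^+ 2 / 2 * `|x| by rewrite exprSr mulrAC.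
apply: (@ler_dist_derive (fun y => sin y - y) (fun y => cos y - 1)).
- by rewrite sin0 subr0.
- move=> y yx; rewrite distrC ger0_norm ?subr_cos_ge0 //.
  apply: le_trans (subr_cos_le2 y) _; rewrite ler_wpM2r //.
  by rewrite -[y ^+ 2]real_normK ?num_real // lerXn2r ?nnegrE.
Qed.

(** The mean value theorem gives a bound of order |x|^4, which is enough for
    |x| <= 1; beyond that, the difference lies between 0 and x^2 / 2. *)
Lemma ler_norm_cos_sub3 x : `|cos x - (1 - x ^+ 2 / 2)| <= `|x| ^+ 3 / 2.
Proof.
have -> : cos x - (1 - x ^+ 2 / 2) = cos x - 1 + x ^+ 2 / 2 by ring.
have [x1|x1] := leP `|x| 1; last first.
  rewrite ger0_norm; last by have := subr_cos_le2 x; lra.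
  have := subr_cos_ge0 x; rewrite -[x ^+ 2]real_normK ?num_real // exprS.
  have : 0 <= `|x| ^+ 2 by rewrite exprn_ge0.
  nra.
apply: (@le_trans _ _ (`|x| ^+ 3 / 2 * `|x|)); last first.
  by rewrite ler_piMr // divr_ge0 // exprn_ge0.
apply: (@ler_dist_derive (fun y => cos y - 1 + y ^+ 2 / 2)
  (fun y => - sin y + y)).
- by rewrite cos0 expr0n /= mul0r subrr addr0.
- move=> y /=; apply: is_derive_eq; rewrite /GRing.scale /=.
  by field.
- move=> y yx; rewrite addrC distrC.
  apply: le_trans (ler_norm_sin_sub3 y) _.
  by rewrite ler_wpM2r // lerXn2r ?nnegrE.
Qed.

Lemma normc_expi_sub1 x : Normc.normc (expi x - 1) <= `|x|.
Proof.
rewrite -(ler_pXn2r (n := 2)) ?nnegrE ?normc_ge0 // normc_sqr /= oppr0 addr0.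
rewrite real_normK ?num_real //.
have := cos2Dsin2 x; have := subr_cos_le2 x; nra.
Qed.

Lemma normc_expi_taylor x :
  Normc.normc (expi x - ((1 - x ^+ 2 / 2) +i* x)%C) <= `|x| ^+ 3.
Proof.
apply: le_trans (normc_le_ReIm _) _ => /=.
by rewrite [leRHS]splitr lerD ?ler_norm_cos_sub3 ?ler_norm_sin_sub3.
Qed.

Lemma ler_norm_sinM n x : `|sin (n%:R * x)| <= n%:R * `|sin x|.
Proof.
elim: n => [|n IH]; first by rewrite !mul0r sin0 normr0.
rewrite -natr1 !mulrDl !mul1r sinD (le_trans (ler_normD _ _)) // !normrM lerD //.
  apply: le_trans IH; rewrite ler_piMr // ler_norml cos_geN1 cos_le1 //.
by rewrite ler_piMl // ler_norml cos_geN1 cos_le1.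
Qed.

Lemma sin_ge_half x : 0 <= x <= 1 -> x / 2 <= sin x.
Proof.
move=> /andP[x0 x1]; have := ler_norm_sin_sub3 x.
rewrite ler_norml (ger0_norm x0) => /andP[+ _].
have : x ^+ 3 <= x by rewrite exprS ler_piMr // exprn_ile1.
lra.
Qed.

(** By Bezout x is an integral combination of a x and b x, and |sin| is
    subadditive: if x is far from the multiples of pi, so is a x or b x. *)
Lemma sin_coprime (a b : nat) : (0 < a)%N -> coprime a b ->
  exists2 K : R, 0 < K &
  forall x, `|sin x| <= K * `|sin (a%:R * x)| \/ `|sin x| <= K * `|sin (b%:R * x)|.
Proof.
move=> a0 ab; case: (egcdnP b a0) => u v; rewrite (eqP ab) => e _.
exists ((u + v)%:R + 1) => [|x]; first by rewrite ltr_wpDl.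
have H : `|sin x| <= u%:R * `|sin (a%:R * x)| + v%:R * `|sin (b%:R * x)|.
  have -> : x = u%:R * (a%:R * x) - v%:R * (b%:R * x).
    by rewrite !mulrA -mulrBl -!natrM e natrD addrC addKr mul1r.
  have E : u%:R * (a%:R * x) - v%:R * (b%:R * x) = x.
    by rewrite !mulrA -mulrBl -!natrM e natrD addrC addKr mul1r.
  rewrite {1}sinB (le_trans (ler_normB _ _)) // !normrM E.
  apply: lerD.
    apply: le_trans (ler_norm_sinM _ _); rewrite ler_piMr // ler_norml.
    by rewrite cos_geN1 cos_le1.
  apply: le_trans (ler_norm_sinM _ _); rewrite ler_piMl // ler_norml.
  by rewrite cos_geN1 cos_le1.
rewrite natrD; have [sab|sab] := leP `|sin (a%:R * x)| `|sin (b%:R * x)|; [right|left].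
  have := ler0n R u; have := ler0n R v; have := normr_ge0 (sin (b%:R * x)); nra.
have := ler0n R u; have := ler0n R v; have := normr_ge0 (sin (a%:R * x)); nra.
Qed.

End Trigonometry.

(** * Characteristic functions of geometric variables *)

(** The characteristic function at [h] of a geometric variable with mean [w],
    centred. *)
Definition geom_char (R : realType) (w h : R) : R[i] :=
  expi (- (h * w)) / (1 - w%:C%C * (expi h - 1)).

Section GeometricFactor.
Context (R : realType).
Implicit Types w h x y : R.

Lemma normc_geom_den w h :
  Normc.normc (1 - w%:C%C * (expi h - 1)) ^+ 2 =
  1 + 2 * (w * (1 + w)) * (1 - cos h).
Proof.
rewrite normc_sqr /=; have := cos2Dsin2 h; move: (cos h) (sin h) => c d cd.
have -> : 1 - (w * (c - 1) - 0 * (d - 0)) = 1 + w - w * c by ring.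
have -> : 0 - (w * (d - 0) + 0 * (c - 1)) = - (w * d) by ring.
rewrite sqrrN exprMn.
have -> : d ^+ 2 = 1 - c ^+ 2 by lra.
ring.
Qed.

Lemma geom_den_ge1 w h : 0 <= w ->
  1 <= Normc.normc (1 - w%:C%C * (expi h - 1)).
Proof.
move=> w0; rewrite -(ler_pXn2r (n := 2)) ?nnegrE ?normc_ge0 // expr1n.
by rewrite normc_geom_den lerDl mulr_ge0 ?subr_cos_ge0 ?mulr_ge0 ?addr_ge0.
Qed.

Lemma normc_geom_char_sqr w h :
  Normc.normc (geom_char w h) ^+ 2 = (1 + 2 * (w * (1 + w)) * (1 - cos h))^-1.
Proof.
by rewrite Normc.normcM normc_expi mul1r Normc.normcV exprVn normc_geom_den.
Qed.

Lemma normc_geom_char_le1 w h : 0 <= w -> Normc.normc (geom_char w h) <= 1.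
Proof.
move=> w0; rewrite Normc.normcM normc_expi mul1r Normc.normcV.
by rewrite invf_le1 ?geom_den_ge1 // (lt_le_trans ltr01) // geom_den_ge1.
Qed.

Lemma expR_sub_taylor1 x : 0 <= x ->
  0 <= expR (- x) - 1 + x /\ expR (- x) - 1 + x <= x /\
  expR (- x) - 1 + x <= x ^+ 2.
Proof.
move=> x0; have e1 := expR_ge1Dx (- x); have e2 := expR_ge1Dx x.
have e3 : expR (- x) <= 1 by rewrite -expR0 ler_expR oppr_le0.
split; first lra.
split; first lra.
have e4 : expR (- x) <= (1 + x)^-1.
  by rewrite expRN lef_pV2 ?posrE ?expR_gt0 // ltr_wpDr.
have : (1 + x)^-1 * (1 + x) = 1 by rewrite mulVf // gt_eqF // ltr_wpDr.
move: ((1 + x)^-1) e4 => i e4; nra.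
Qed.

(** Third order Taylor expansion. The denominator D of [geom_char] has modulus at
    least 1, so it suffices to compare exp (- i h w) with D exp (- b), where b is
    the exponent of the Gaussian; the terms of order at most 2 cancel because the
    variance is w (1 + w). *)
Lemma geom_char_gauss w h : 0 <= w ->
  Normc.normc (geom_char w h - (expR (- (w * (1 + w) * h ^+ 2 / 2)))%:C%C) <=
  4 * (w * (1 + w) ^+ 2) * `|h| ^+ 3.
Proof.
move=> w0; set b := w * (1 + w) * h ^+ 2 / 2; set E := expR (- b).
have D1 := geom_den_ge1 h w0.
set D := 1 - _ in D1.
have D0 : D != 0.
  apply/eqP => D0; move: D1; rewrite D0.
  by rewrite Normc.normc0 leNgt ltr01.
have -> : geom_char w h - E%:C%C = (expi (- (h * w)) - E%:C%C * D) / D.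
  by rewrite /geom_char -/D mulrBl mulfK.
rewrite Normc.normcM Normc.normcV.
apply: (@le_trans _ _ (Normc.normc (expi (- (h * w)) - E%:C%C * D))).
  by rewrite ler_piMr ?normc_ge0 // invf_le1 // (lt_le_trans ltr01).
have b0 : 0 <= b by rewrite divr_ge0 // mulr_ge0 ?sqr_ge0 // mulr_ge0 ?addr_ge0.
have [r3p [r3b r3b2]] := expR_sub_taylor1 b0.
rewrite -/E in r3p r3b r3b2.
pose r1 := expi (- (h * w)) - ((1 - (- (h * w)) ^+ 2 / 2) +i* (- (h * w)))%C.
pose r2 := expi h - ((1 - h ^+ 2 / 2) +i* h)%C.
have -> : expi (- (h * w)) - E%:C%C * D =
    r1 + (- (E - 1 + b)%:C%C + (w%:C%C * r2 - ((1 - E) * w)%:C%C * (expi h - 1))).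
  rewrite /r1 /r2 /D /b; apply/eqP; rewrite eq_complex /=.
  by apply/andP; split; apply/eqP; field.
set a := `|h|.
have a0 : 0 <= a by exact: normr_ge0.
have n1 : Normc.normc r1 <= w ^+ 3 * a ^+ 3.
  apply: le_trans (normc_expi_taylor _) _.
  by rewrite normrN normrM exprMn mulrC (ger0_norm w0).
have n2 : Normc.normc (w%:C%C * r2) <= w * a ^+ 3.
  by rewrite Normc.normcM normc_real ger0_norm // ler_wpM2l // normc_expi_taylor.
have n3 : Normc.normc (((1 - E) * w)%:C%C * (expi h - 1)) <= b * w * a.
  have E1 : 0 <= 1 - E by rewrite subr_ge0 /E -expR0 ler_expR oppr_le0.
  rewrite Normc.normcM normc_real ger0_norm ?mulr_ge0 //.
  apply: ler_pM; rewrite ?mulr_ge0 ?normc_ge0 ?normc_expi_sub1 //.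
  by rewrite ler_wpM2r //; lra.
(* the quadratic bound on E - 1 + b serves for small h, the linear one for
   large h; they meet where (1 + w) |h| = 1 *)
have n4 : Normc.normc (- (E - 1 + b)%:C%C) <= w * (1 + w) ^+ 2 * a ^+ 3 / 2.
  rewrite normcN normc_real ger0_norm //.
  have ba : b = w * (1 + w) * a ^+ 2 / 2 by rewrite /b /a real_normK ?num_real.
  have [c1|c1] := leP ((1 + w) * a) 1.
    apply: le_trans r3b2 _; rewrite ba.
    have -> : (w * (1 + w) * a ^+ 2 / 2) ^+ 2 =
      (w * (1 + w) ^+ 2 * a ^+ 3 / 2) * (w * a / 2) by field.
    rewrite ler_piMr ?divr_ge0 ?mulr_ge0 ?exprn_ge0 ?addr_ge0 //.
    have := mulr_ge0 w0 a0; nra.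
  apply: le_trans r3b _; rewrite ba.
  have -> : w * (1 + w) ^+ 2 * a ^+ 3 / 2 =
      (w * (1 + w) * a ^+ 2 / 2) * ((1 + w) * a) by field.
  by rewrite ler_peMr ?(ltW c1) // divr_ge0 // !mulr_ge0 ?exprn_ge0 ?addr_ge0.
apply: le_trans (le_normcD _ _) _.
apply: (@le_trans _ _ (w ^+ 3 * a ^+ 3 + (w * (1 + w) ^+ 2 * a ^+ 3 / 2 +
   (w * a ^+ 3 + b * w * a)))).
  apply: lerD n1 _; apply: le_trans (le_normcD _ _) _; apply: lerD n4 _.
  apply: le_trans (le_normcD _ _) _; rewrite normcN; exact: lerD.
have -> : b * w * a = w ^+ 2 * (1 + w) / 2 * a ^+ 3.
  by rewrite /b -[h ^+ 2]real_normK ?num_real // -/a; field.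
have -> : w ^+ 3 * a ^+ 3 + (w * (1 + w) ^+ 2 * a ^+ 3 / 2 +
   (w * a ^+ 3 + w ^+ 2 * (1 + w) / 2 * a ^+ 3)) =
   (w ^+ 3 + (w * (1 + w) ^+ 2 / 2 + (w + w ^+ 2 * (1 + w) / 2))) * a ^+ 3 by field.
rewrite ler_wpM2r ?exprn_ge0 //.
have : 0 <= w ^+ 3 by rewrite exprn_ge0.
have : 0 <= w ^+ 2 by rewrite exprn_ge0.
have -> : (1 + w) ^+ 2 = 1 + 2 * w + w ^+ 2 by ring.
rewrite !mulrDr !mulr1 -!exprSr; have -> : w * w ^+ 2 = w ^+ 3 by ring.
have -> : w * (2 * w) = 2 * w ^+ 2 by ring.
lra.
Qed.

Lemma normc_prod_sub (a b : nat -> R[i]) n :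
  (forall i, Normc.normc (a i) <= 1) -> (forall i, Normc.normc (b i) <= 1) ->
  Normc.normc (\prod_(i < n) a i - \prod_(i < n) b i) <=
  \sum_(i < n) Normc.normc (a i - b i).
Proof.
move=> a1 b1; elim: n => [|n IH]; first by rewrite !big_ord0 subrr Normc.normc0.
rewrite !big_ord_recr /=.
have -> : (\prod_(i < n) a i) * a n - (\prod_(i < n) b i) * b n =
  (\prod_(i < n) a i - \prod_(i < n) b i) * a n + \prod_(i < n) b i * (a n - b n).
  by ring.
apply: le_trans (le_normcD _ _) _; rewrite !Normc.normcM; apply: lerD.
  by apply: le_trans IH; rewrite ler_piMr ?normc_ge0.
rewrite ler_piMl ?normc_ge0 // normc_prod.
by apply: prodr_ile1 => i _; rewrite normc_ge0 b1.
Qed.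

End GeometricFactor.

(** * Domination of the characteristic function *)

Section Domination.
Context (R : realType) (k : nat).
Hypothesis k1 : (1 <= k)%N.
Implicit Types (s theta : R) (i n N J : nat).

(** The inverse square modulus of the characteristic function of (i + 1)^k G_i
    at theta, for the parameter t = 1 - s; see [normc_geom_char_sqr]. *)
Definition damping s theta i : R :=
  1 + 2 * (geom_mean k (1 - s) i * (1 + geom_mean k (1 - s) i)) *
    (1 - cos ((i.+1 ^ k)%:R * theta)).

Lemma damping_ge1 s theta i : 0 < s <= 1 -> 1 <= damping s theta i.
Proof.
move=> /andP[s0 s1]; rewrite /damping lerDl mulr_ge0 ?subr_cos_ge0 //.
by rewrite mulr_ge0 // geom_var_ge0 // subr_ge0 s1 gtrBl.
Qed.

Lemma damping_ge s theta i N : 0 < s <= 1 -> 2 * s * (N ^ k)%:R <= 1 ->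
  (i < N)%N ->
  1 + 2 * (sin ((i.+1 ^ k)%:R * (theta / 2)) / ((i.+1 ^ k)%:R * s)) ^+ 2 <=
  damping s theta i.
Proof.
move=> s01 sN iN; rewrite /damping lerD2l.
have := geom_var_ge k1 s01 sN iN; set v := _ * (1 + _); set x := _ * s => vx.
rewrite subr_cos -[_ * theta / 2]mulrA; move: (sin _) => y.
have -> : 2 * v * (2 * y ^+ 2) = (4 * y ^+ 2) * v by ring.
have -> : 2 * (y / x) ^+ 2 = (4 * y ^+ 2) * (2 * x ^+ 2)^-1.
  field; have /andP[s0 _] := s01.
  by rewrite mulf_neq0 ?(gt_eqF s0) // pnatr_eq0 expn_eq0.
by rewrite ler_wpM2l // mulr_ge0 // sqr_ge0.
Qed.

(** If m |theta| <= 2 then |sin (m theta / 2)| >= m |theta| / 4, and the factor m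
    cancels: all these parts contribute the same amount. *)
Lemma damping_major s theta i N J : 0 < s <= 1 -> 2 * s * (N ^ k)%:R <= 1 ->
  `|theta| / 2 * (J ^ k)%:R <= 1 -> (i < N)%N -> (i < J)%N ->
  1 + (theta / s) ^+ 2 / 8 <= damping s theta i.
Proof.
move=> s01 sN tJ iN iJ; apply: le_trans (damping_ge theta s01 sN iN).
have /andP[s0 _] := s01.
have m0 : 0 < (i.+1 ^ k)%:R :> R by rewrite ltr0n expn_gt0.
rewrite lerD2l; set m := _%:R in m0 *.
have y1 : m * (`|theta| / 2) <= 1.
  by apply: le_trans tJ; rewrite mulrC ler_wpM2l ?divr_ge0 // ler_nat leq_exp2r.
have y0 : 0 <= m * (`|theta| / 2) by rewrite mulr_ge0 ?divr_ge0 // ltW.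
have := sin_ge_half; move=> /(_ _ (m * (`|theta| / 2))); rewrite y0 y1 => /(_ isT) H.
have S : sin (m * (theta / 2)) ^+ 2 = sin (m * (`|theta| / 2)) ^+ 2.
  have [t0|t0] := leP 0 theta; first by rewrite ger0_norm.
  by rewrite (ltr0_norm t0) mulNr mulrN sinN sqrrN.
rewrite [X in _ <= 2 * X]exprMn S.
apply: (@le_trans _ _ (2 * ((m * (`|theta| / 2) / 2) ^+ 2 * (m * s)^-1 ^+ 2))).
  rewrite !exprMn real_normK ?num_real //.
  rewrite le_eqVlt; apply/orP; left; apply/eqP; field.
  by rewrite !gt_eqF.
rewrite ler_wpM2l // ler_wpM2r ?sqr_ge0 // lerXn2r ?nnegrE ?divr_ge0 //.
by apply: le_trans H; rewrite divr_ge0.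
Qed.

Lemma ler_prod_widen (f : nat -> R) M n : (M <= n)%N -> (forall i, 1 <= f i) ->
  \prod_(i < M) f i <= \prod_(i < n) f i.
Proof.
move=> Mn f1; have f0 i : 0 <= f i by exact: le_trans (f1 i).
rewrite -!(big_mkord predT f) [leRHS](big_cat_nat (n := M)) //= ler_peMr //.
  by apply: prodr_ge0.
elim/big_rec: _ => [//|i x _ x1]; rewrite (le_trans x1) // ler_peMl //.
exact: le_trans x1.
Qed.

Lemma bernoulli (x : R) n : 0 <= x -> 1 + n%:R * x <= (1 + x) ^+ n.
Proof.
move=> x0; elim: n => [|n IH]; first by rewrite mul0r addr0 expr0.
have x1 : 0 <= 1 + x by rewrite addr_ge0.
rewrite exprS; apply: le_trans (ler_wpM2l x1 IH).
have := ler0n R n; rewrite -natr1; nra.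
Qed.

(** Half of the N factors give N X / 24 by Bernoulli's inequality, the other half
    its square. Used with X = (theta / s)^2 when all the parts up to N^k
    contribute. *)
Lemma growth_major (X : R) N : 0 <= X -> (2 <= N)%N ->
  (1 + N%:R * X) ^+ 2 <= 24 ^+ 2 * (1 + X / 8) ^+ N.
Proof.
move=> X0 N2; pose h := (N./2)%N.
have hN : N%:R <= 3 * h%:R :> R by rewrite -natrM ler_nat /h; lia.
have X8 : 0 <= X / 8 by rewrite divr_ge0.
have B := bernoulli h X8.
have h0 := ler0n R h.
have H : 1 + N%:R * X <= 24 * (1 + X / 8) ^+ h.
  have := ler_wpM2r X0 hN; lra.
apply: (@le_trans _ _ ((24 * (1 + X / 8) ^+ h) ^+ 2)).
  by rewrite lerXn2r ?nnegrE ?mulr_ge0 ?exprn_ge0 ?addr_ge0 ?mulr_ge0.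
rewrite exprMn ler_wpM2l ?exprn_ge0 // -exprM ler_weXn2l ?lerDl //.
by rewrite /h; lia.
Qed.

(** Used when only J < N parts contribute. The bound on N makes N X of order at
    most J X^2, which half of the J factors dominate by Bernoulli's inequality;
    the other half gives the square. *)
Lemma growth_middle (X : R) N J : (4 <= J)%N -> 0 <= X ->
  N%:R <= X * J.+1%:R ->
  (1 + N%:R * X) ^+ 2 <= (8 ^+ 3) ^+ 2 * (1 + X / 8) ^+ J.
Proof.
move=> J4 X0 NX; pose h := (J %/ 4)%N.
have hJ : J.+1%:R <= 8 * h%:R :> R by rewrite -natrM ler_nat /h; lia.
have h1 : 1 <= h%:R :> R by rewrite ler1n /h; lia.
have X8 : 0 <= X / 8 by rewrite divr_ge0.
have B := bernoulli h X8.
have N0 := ler0n R N.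
have H : 1 + N%:R * X <= 8 ^+ 3 * ((1 + X / 8) ^+ h) ^+ 2.
  have B2 : (1 + h%:R * (X / 8)) ^+ 2 <= ((1 + X / 8) ^+ h) ^+ 2.
    by rewrite lerXn2r ?nnegrE ?exprn_ge0 ?addr_ge0 ?mulr_ge0.
  have H1 : N%:R * X <= 8 * (h%:R ^+ 2 * X ^+ 2).
    apply: (@le_trans _ _ (X * J.+1%:R * X)); first by rewrite ler_wpM2r.
    rewrite mulrAC -expr2 mulrC mulrA ler_wpM2r ?exprn_ge0 //.
    apply: le_trans hJ _; rewrite ler_wpM2l // expr2; nra.
  apply: le_trans (ler_wpM2l _ B2) => //; rewrite expr2.
  have P : 0 <= h%:R * X by rewrite mulr_ge0.
  have -> : (1 + h%:R * (X / 8)) * (1 + h%:R * (X / 8)) =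
    1 + h%:R * X / 4 + (h%:R ^+ 2 * X ^+ 2) / 64 by field.
  lra.
apply: (@le_trans _ _ ((8 ^+ 3 * ((1 + X / 8) ^+ h) ^+ 2) ^+ 2)).
  by rewrite lerXn2r ?nnegrE ?mulr_ge0 ?exprn_ge0 ?addr_ge0 ?mulr_ge0.
rewrite exprMn ler_wpM2l ?exprn_ge0 // -!exprM ler_weXn2l ?lerDl //.
by rewrite /h; lia.
Qed.

Lemma sin_half_ge (y theta : R) : 0 <= y -> y <= `|theta| / 2 -> `|theta| <= pi ->
  sin y <= `|sin (theta / 2)|.
Proof.
move=> y0 yt tp.
have -> : `|sin (theta / 2)| = `|sin (`|theta| / 2)|.
  have [t0|t0] := leP 0 theta; first by rewrite (ger0_norm t0).
  by rewrite (ltr0_norm t0) mulNr sinN normrN.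
apply: le_trans (ler_norm _).
have p2 : `|theta| / 2 <= pi / 2 by rewrite ler_pM2r.
have np : - (pi / 2) <= 0 :> R by rewrite oppr_le0 divr_ge0 // pi_ge0.
rewrite leNgt; apply/negP; rewrite ltr_sin ?in_itv /=.
- by rewrite ltNge yt.
- by rewrite p2 (le_trans np) // divr_ge0.
- by rewrite (le_trans np) //= (le_trans yt).
Qed.

(** For one of the first few parts, a sine bounded away from 0 makes the factor of
    the full order s^(-2). *)
Lemma damping_minor s theta i N (d : R) : 0 < s <= 1 ->
  2 * s * (N ^ k)%:R <= 1 -> (i < 7)%N -> (i < N)%N -> 0 <= d ->
  d <= `|sin ((i.+1 ^ k)%:R * (theta / 2))| ->
  2 * (d / (7 ^ k)%:R) ^+ 2 / s ^+ 2 <= damping s theta i.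
Proof.
move=> s01 sN i7 iN d0 dsin; have /andP[s0 _] := s01.
apply: le_trans (damping_ge theta s01 sN iN).
apply: (@le_trans _ _ (2 * (`|sin ((i.+1 ^ k)%:R * (theta / 2))| /
   ((i.+1 ^ k)%:R * s)) ^+ 2)); last first.
  by rewrite !exprMn real_normK ?num_real // lerDr.
have m0 : 0 < (i.+1 ^ k)%:R :> R by rewrite ltr0n expn_gt0.
have M0 : 0 < (7 ^ k)%:R :> R by rewrite ltr0n expn_gt0.
rewrite -mulrA -expr_div_n ler_wpM2l // lerXn2r ?nnegrE //.
- by rewrite !divr_ge0 // ltW.
- by rewrite divr_ge0 // mulr_ge0 // ltW.
rewrite -mulrA -invfM; apply: ler_pM => //.
  by rewrite invr_ge0 mulr_ge0 // ltW.
rewrite lef_pV2 ?posrE ?mulr_gt0 // ler_pM2r // ler_nat leq_exp2r //.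
Qed.

(** Let J be the integer part of (2 / |theta|)^(1/k). The parts j^k with j at
    most N and J contribute a factor 1 + (theta / s)^2 / 8 each by [damping_major],
    which suffices as soon as J >= 4. For J <= 3, theta / 2 stays away from the
    multiples of pi, hence so do m theta / 2 for m = 1, for one of m = 2^k, 3^k and
    for one of m = 5^k, 7^k; three factors of order s^(-2) suffice, because
    N s <= 1. *)
Lemma char_domination : exists2 C : R, 0 < C & forall s N n theta,
  0 < s <= 1 -> 2 * s * (N ^ k)%:R <= 1 -> (7 <= N)%N -> (N <= n)%N ->
  `|theta| <= pi ->
  (1 + N%:R * (theta / s) ^+ 2) ^+ 2 <= C * \prod_(i < n) damping s theta i.
Proof.
have [K1 K10 HK1] := @sin_coprime R (2 ^ k) (3 ^ k)
  (ltac:(by rewrite expn_gt0)) (ltac:(by rewrite coprimeXl // coprimeXr)).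
have [K2 K20 HK2] := @sin_coprime R (5 ^ k) (7 ^ k)
  (ltac:(by rewrite expn_gt0)) (ltac:(by rewrite coprimeXl // coprimeXr)).
pose y : R := ((4 ^ k)%:R)^-1.
have y0 : 0 < y by rewrite invr_gt0 ltr0n expn_gt0.
have y1 : y <= 1 by rewrite invf_le1 ?ltr0n ?ler1n expn_gt0.
pose d := sin y / (1 + K1 + K2).
have sy0 : 0 < sin y.
  apply: lt_le_trans (sin_ge_half _); first by rewrite divr_gt0.
  by rewrite ltW.
have K0 : 0 < 1 + K1 + K2 by rewrite !addr_gt0.
have d0 : 0 < d by rewrite divr_gt0.
pose c := 2 * (d / (7 ^ k)%:R) ^+ 2.
have c0 : 0 < c by rewrite mulr_gt0 // exprn_gt0 // divr_gt0 // ltr0n expn_gt0.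
exists (24 ^+ 2 + (8 ^+ 3) ^+ 2 + 81 / c ^+ 3) => [|s N n theta s01 sN N7 Nn tp].
  by rewrite addr_gt0 ?divr_gt0 ?exprn_gt0 // addr_gt0 ?exprn_gt0.
have /andP[s0 s1] := s01.
have f1 i : 1 <= damping s theta i by exact: damping_ge1.
have f0 i : 0 <= damping s theta i by exact: le_trans (f1 i).
set X := (theta / s) ^+ 2; set P := \prod_(i < n) _.
have P0 : 0 <= P by exact: prodr_ge0.
have X0 : 0 <= X by exact: sqr_ge0.
have c3 : 0 < 81 / c ^+ 3 by rewrite divr_gt0 // exprn_gt0.
have a2 : 0 <= 24 ^+ 2 * P by rewrite mulr_ge0 ?exprn_ge0.
have a5 : 0 <= (8 ^+ 3) ^+ 2 * P by rewrite mulr_ge0 ?exprn_ge0.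
have a8 : 0 <= 81 / c ^+ 3 * P by rewrite mulr_ge0 // ltW.
rewrite !mulrDl.
have powP M : (M <= n)%N -> (forall i, (i < M)%N -> 1 + X / 8 <= damping s theta i) ->
    (1 + X / 8) ^+ M <= P.
  move=> Mn H; apply: le_trans (ler_prod_widen Mn f1).
  rewrite -[X in _ ^+ X]card_ord -prodr_const; apply: ler_prod => i _.
  by rewrite addr_ge0 ?divr_ge0 //= H.
have [t0|t0] := eqVneq theta 0.
  have -> : X = 0 by rewrite /X t0 mul0r expr0n.
  have P1 : 1 <= P.
    by apply: le_trans (ler_prod_widen (leq0n n) f1); rewrite big_ord0.
  have : 1 <= 24 ^+ 2 * P by apply: le_trans P1 _; rewrite ler_peMl //; lra.
  by rewrite mulr0 addr0 expr1n; lra.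
have t20 : 0 < `|theta| / 2 by rewrite divr_gt0 // normr_gt0.
have [J [tJ tJ1]] := floor_root k1 t20.
have [NJ|JN] := leqP N J.
  have := growth_major X0 (leq_trans (isT : (2 <= 7)%N) N7).
  have : (1 + X / 8) ^+ N <= P.
    by apply: powP => // i iN; apply: damping_major s01 sN tJ iN (leq_trans iN NJ).
  rewrite -(ler_pM2l (_ : 0 < 24 ^+ 2 :> R)) ?exprn_gt0 //; lra.
have [J4|J3] := leqP 4 J.
  have PJ : (1 + X / 8) ^+ J <= P.
    apply: powP => [|i iJ]; first by rewrite ltnW // (leq_trans JN).
    exact: damping_major s01 sN tJ (ltn_trans iJ JN) iJ.
  have NX : N%:R <= X * J.+1%:R.
    have A : N%:R / J.+1%:R <= `|theta| / s.
      rewrite ler_pdivrMr ?ltr0n // mulrAC ler_pdivlMr //.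
      have E := leq_mulX_cross k1 JN.
      have E' : N%:R * (J.+1 ^ k)%:R <= (N ^ k)%:R * J.+1%:R :> R.
        by rewrite -!natrM ler_nat.
      have jk0 : 0 < (J.+1 ^ k)%:R :> R by rewrite ltr0n expn_gt0.
      rewrite -(ler_pM2r jk0).
      apply: (@le_trans _ _ ((N ^ k)%:R * s * J.+1%:R)).
        by rewrite mulrAC [leRHS]mulrAC ler_wpM2r // ltW.
      have J0 : 0 <= J.+1%:R :> R by [].
      rewrite [leRHS]mulrAC ler_wpM2r //; lra.
    have A1 : 1 <= N%:R / J.+1%:R :> R.
      by rewrite ler_pdivlMr ?ltr0n // mul1r ler_nat.
    have XE : X = (`|theta| / s) ^+ 2.
      by rewrite /X !expr_div_n real_normK ?num_real.
    have A2 := le_trans A1 A.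
    rewrite -ler_pdivrMr ?ltr0n // XE; apply: le_trans A _.
    by rewrite expr2 ler_peMr // (le_trans ler01).
  have := growth_middle J4 X0 NX.
  move: PJ; rewrite -(ler_pM2l (_ : 0 < (8 ^+ 3) ^+ 2 :> R)) ?exprn_gt0 //; lra.
have yt : y <= `|theta| / 2.
  rewrite /y -[leLHS]mul1r ler_pdivrMr ?ltr0n ?expn_gt0 //.
  by rewrite (le_trans (ltW tJ1)) // ler_wpM2l ?(ltW t20) // ler_nat leq_exp2r.
have ys := sin_half_ge (ltW y0) yt tp.
have dle (K u : R) : 0 < K -> K <= 1 + K1 + K2 ->
    `|sin (theta / 2)| <= K * `|sin u| -> d <= `|sin u|.
  move=> K0' KK H; rewrite /d ler_pdivrMr // mulrC.
  by apply: le_trans ys _; apply: le_trans H _; rewrite ler_wpM2r.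
have big i : (i < 7)%N -> d <= `|sin ((i.+1 ^ k)%:R * (theta / 2))| ->
    c / s ^+ 2 <= damping s theta i.
  by move=> i7; apply: damping_minor s01 sN i7 (leq_trans i7 N7) (ltW d0).
have g0 : c / s ^+ 2 <= damping s theta 0.
  apply: big => //; rewrite exp1n mul1r; apply: (dle 1) => //.
    by rewrite -addrA lerDl addr_ge0 // ltW.
  by rewrite mul1r.
have pairP i j : c / s ^+ 2 <= damping s theta i \/ c / s ^+ 2 <= damping s theta j ->
    c / s ^+ 2 <= damping s theta i * damping s theta j.
  by case=> H; apply: le_trans H _; rewrite ?ler_peMr ?ler_peMl.
have g1 : c / s ^+ 2 <= damping s theta 1 * damping s theta 2.
  apply: pairP; case: (HK1 (theta / 2)) => H; [left|right]; apply: big => //;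
    by apply: (dle K1) H => //; lra.
have g2 : c / s ^+ 2 <= damping s theta 4 * damping s theta 6.
  apply: pairP; case: (HK2 (theta / 2)) => H; [left|right]; apply: big => //;
    by apply: (dle K2) H => //; lra.
have cs0 : 0 <= c / s ^+ 2 by rewrite divr_ge0 ?exprn_ge0 ?(ltW c0) ?(ltW s0).
have g : (c / s ^+ 2) ^+ 3 <= P.
  apply: le_trans (ler_prod_widen (leq_trans N7 Nn) f1).
  move: (c / s ^+ 2) cs0 g0 g1 g2 => a a0 g0 g1 g2.
  rewrite !big_ord_recl big_ord0 /= /bump /= mulr1 !exprS expr0 mulr1.
  apply: ler_pM => //; first by rewrite mulr_ge0.
  rewrite mulrA; apply: ler_pM => //.
  rewrite [leRHS](_ : _ = (damping s theta 4 * damping s theta 6) *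
    (damping s theta 3 * damping s theta 5)); last by ring.
  apply: le_trans g2 _; rewrite ler_peMr ?mulr_ge0 //.
  by apply: le_trans (f1 3) _; rewrite ler_peMr.
have Ns : N%:R * s <= 2^-1.
  have : N%:R <= (N ^ k)%:R :> R.
    by rewrite ler_nat -{1}(expn1 N) leq_pexp2l // (leq_trans _ N7).
  move=> /(ler_wpM2r (ltW s0)); lra.
have XN : N%:R * X <= 8 / s ^+ 3.
  rewrite /X expr_div_n -[theta ^+ 2]real_normK ?num_real //.
  have t16 : `|theta| ^+ 2 <= 16.
    have -> : (16 : R) = 4 ^+ 2 by ring.
    rewrite lerXn2r ?nnegrE //; apply: le_trans tp _.
    by have := @pihalf_lt2 R; rewrite ltr_pdivrMr //; lra.
  have -> : N%:R * (`|theta| ^+ 2 / s ^+ 2) = (N%:R * s) * `|theta| ^+ 2 / s ^+ 3.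
    by field; rewrite gt_eqF.
  rewrite ler_wpM2r ?invr_ge0 ?exprn_ge0 ?(ltW s0) //.
  have -> : (8 : R) = 2^-1 * 16 by field.
  by apply: ler_pM => //; rewrite ?mulr_ge0 ?exprn_ge0 // ltW.
have s3 : 1 <= s^-1 ^+ 3 by rewrite exprn_ege1 // invf_ge1.
have H9 : (1 + N%:R * X) ^+ 2 <= (9 * s^-1 ^+ 3) ^+ 2.
  rewrite -exprVn in XN; move: (s^-1 ^+ 3) s3 XN => u u1 XN.
  have u9 : 0 <= 9 * u by rewrite mulr_ge0 // (le_trans ler01).
  have L : 1 + N%:R * X <= 9 * u.
    apply: le_trans (lerD u1 XN) _.
    by have -> : u + 8 * u = 9 * u by ring.
  have NX0 : 0 <= 1 + N%:R * X.
    exact: addr_ge0 ler01 (mulr_ge0 (ler0n R N) X0).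
  by rewrite lerXn2r ?nnegrE.
apply: (@le_trans _ _ (81 / c ^+ 3 * P)); last by lra.
apply: le_trans H9 _.
have -> : (9 * s^-1 ^+ 3) ^+ 2 = 81 / c ^+ 3 * (c / s ^+ 2) ^+ 3.
  by field; rewrite !gt_eqF.
by rewrite ler_wpM2l // ltW.
Qed.

End Domination.

(** * The law of X_t *)

Section DiscreteLaw.
Context (R : realType) (d : measure_display) (T : measurableType d).
Context (P : probability T R) (X : {RV P >-> nat}) (p : nat -> R).
Hypothesis law : forall n, P (X @^-1` [set n]) = (p n)%:E.

Let F n := X @^-1` [set n].

Let mF n : measurable (F n).
Proof. by rewrite /F -[X in measurable X]setTI; exact: measurable_funP. Qed.

Let tF : trivIset setT F.
Proof. by move=> i j _ _ [w [/= <- <-]]. Qed.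

Let UF : \bigcup_n F n = setT.
Proof. by apply/seteqP; split => // w _; exists (X w). Qed.

Let mg (g : nat -> R) : measurable_fun [set: T] (EFin \o (g \o X)).
Proof.
by apply/measurable_EFinP; exact: measurableT_comp.
Qed.

Lemma law_ge0 n : 0 <= p n.
Proof. by rewrite -lee_fin -law. Qed.

Let integral_fiber (g : nat -> R) n :
  (\int[P]_(w in F n) (g (X w))%:E = (g n * p n)%:E)%E.
Proof.
rewrite (eq_integral (cst (g n)%:E)); last by move=> w; rewrite inE => ->.
by rewrite integral_cst // EFinM -law.
Qed.

Lemma nneseries_lim (u : nat -> R) (l : R) : series u @ \oo --> l ->
  (\sum_(n <oo) (u n)%:E = l%:E)%E.
Proof.
move=> ul; apply/cvg_lim => //.
have -> : (fun n => (\sum_(0 <= k < n | xpredT k) (u k)%:E)%E) = EFin \o series u.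
  by apply/funext => n; rewrite /= sumEFin.
by apply: cvg_EFin => //; apply: nearW.
Qed.

Lemma law_integral (g : nat -> R) (l : R) :
  cvgn (series (fun n => `|g n| * p n)) ->
  series (fun n => g n * p n) @ \oo --> l ->
  (\int[P]_w (g (X w))%:E = l%:E)%E.
Proof.
move=> cg gl.
have ig : P.-integrable setT (fun w => (g (X w))%:E).
  apply/integrableP; split; first exact: mg.
  have := @ge0_integral_bigcup _ T R P F
    (EFin \o ((fun n => `|g n|) \o X)) mF.
  rewrite /= UF => /(_ (mg _) (fun _ _ => normr_ge0 _) tF) ->.
  rewrite (eq_eseriesr (g := fun n => (`|g n| * p n)%:E)).
    by rewrite (nneseries_lim cg) ltry.
  by move=> n _; exact: (integral_fiber (fun n => `|g n|)).
have := @integral_bigcup _ T R P F _ tF mF; rewrite UF => /(_ _ ig) ->.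
rewrite (eq_eseriesr (g := fun n => (g n * p n)%:E)); first exact: nneseries_lim.
by move=> n _; exact: integral_fiber.
Qed.

Lemma law_expectation (g : nat -> R) (l : R) :
  cvgn (series (fun n => `|g n| * p n)) ->
  series (fun n => g n * p n) @ \oo --> l ->
  ('E_P[fun w => g (X w)] = l%:E)%E.
Proof. by move=> cg gl; rewrite unlock; exact: law_integral. Qed.

End DiscreteLaw.

Section KhinchinLaw.
Context (R : realType) (k : nat) (t : R).
Hypotheses (k1 : (1 <= k)%N) (t01 : 0 <= t < 1).
Context (d : measure_display) (T : measurableType d).
Context (P : probability T R) (X : {RV P >-> nat}).
Hypothesis law : forall n, P (X @^-1` [set n]) =
  (Pcoef R k n * t ^+ n / limn (pseries (Pcoef R k) t))%:E.

Let Y (w : T) : R := (X w)%:R.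

(** X_t has the same law as the sum of the (i + 1)^k G_i over all i. The
    moments come from [Pcoef_moments],
    and the characteristic function is P_k(t e^(i theta)) / P_k(t), up to the
    centring, which [Pcoef_genfunC] factors. *)
Lemma khinchin_law : exists mu v : R,
  [/\ mean P Y = mu, ('V_P[Y] = v%:E)%E,
      partial_var k t @ \oo --> v
    & forall theta, exists2 phi : R[i],
        (phi = fine 'E_P[fun w => cos (theta * (Y w - mu))] +i*
               fine 'E_P[fun w => sin (theta * (Y w - mu))])%C &
        cvgC (fun n => \prod_(i < n)
          geom_char (geom_mean k t i) ((i.+1 ^ k)%:R * theta)) phi].
Proof.
have /andP[t0 t1] := t01.
have [f [e1 [e2 [f0 [c0 c1 c2] cG cM cV]]]] := Pcoef_moments k1 t01.
have fE : limn (pseries (Pcoef R k) t) = f by apply/cvg_lim.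
have fn0 : f != 0 by rewrite gt_eqF.
pose p n := Pcoef R k n * t ^+ n / f.
have lawp n : P (X @^-1` [set n]) = (p n)%:E by rewrite law fE.
have p0 n : 0 <= p n by exact: (law_ge0 lawp).
pose mu := e1 / f; pose v := e2 / f - mu ^+ 2.
have scale (g : nat -> R) (l : R) : series (fun n => g n * (Pcoef R k n * t ^+ n)) @ \oo --> l ->
    series (fun n => g n * p n) @ \oo --> l / f.
  move=> cl; have -> : (fun n => g n * p n) =
      f^-1 *: (fun n => g n * (Pcoef R k n * t ^+ n)) :> (nat -> R).
    by apply/funext => n; rewrite fctE /p /GRing.scale /=; ring.
  by rewrite seriesZ mulrC; apply: cvgZl_tmp.
have q0 : series p @ \oo --> (1 : R).
  have := scale (fun _ => 1) f; rewrite divff //.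
  have -> : (fun n => 1 * (Pcoef R k n * t ^+ n)) = (fun n => Pcoef R k n * t ^+ n).
    by apply/funext => n; rewrite mul1r.
  have -> : (fun n => 1 * p n) = p by apply/funext => n; rewrite mul1r.
  exact.
have q1 : series (fun n => n%:R * p n) @ \oo --> mu by exact: scale.
have q2 : series (fun n => n%:R ^+ 2 * p n) @ \oo --> e2 / f by exact: scale.
have EY : ('E_P[Y] = mu%:E)%E.
  apply: (law_expectation (g := fun n => n%:R) lawp _ q1).
  rewrite (_ : (fun n => _) = (fun n => n%:R * p n)); first exact: cvgP q1.
  by apply/funext => n; rewrite normr_nat.
have mE : mean P Y = mu by rewrite /mean EY.
exists mu, v; split => //.
  rewrite /variance unlock EY /=.
  have q3 : series (fun n => (n%:R - mu) ^+ 2 * p n) @ \oo --> v.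
    have -> : (fun n => (n%:R - mu) ^+ 2 * p n) =
        (fun n => n%:R ^+ 2 * p n) - (2 * mu) *: (fun n => n%:R * p n) +
        mu ^+ 2 *: p :> (nat -> R).
      by apply/funext => n; rewrite !fctE /GRing.scale /=; ring.
    rewrite !seriesD seriesN !seriesZ.
    have -> : v = e2 / f - (2 * mu) *: mu + mu ^+ 2 *: 1 :> R.
      by rewrite /v /GRing.scale /=; ring.
    by apply: cvgD; [apply: cvgB => //|]; apply: cvgZl_tmp.
  pose g2 n : R := (n%:R - mu) ^+ 2.
  rewrite (_ : 'E_P[_] = 'E_P[fun w => g2 (X w)])%E; last first.
    by congr expectation; apply/funext => w /=; rewrite /g2 expr2.
  apply: (law_expectation (g := fun n => (n%:R - mu) ^+ 2) lawp _ q3).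
  rewrite (_ : (fun n => _) = (fun n => (n%:R - mu) ^+ 2 * p n)).
    exact: cvgP q3.
  by apply/funext => n; rewrite ger0_norm ?sqr_ge0.
move=> theta.
pose z : R[i] := t%:C%C * expi theta.
have nz : Normc.normc z < 1.
  by rewrite Normc.normcM normc_expi mulr1 normc_real ger0_norm.
have zX n : z ^+ n = (t ^+ n)%:C%C * expi (n%:R * theta).
  by rewrite exprMn expiMn rmorphXn.
have [g Gg Sg] := Pcoef_genfunC k1 nz.
pose phi := expi (- (theta * mu)) * (g / f%:C%C).
have fC0 : f%:C%C != 0 by rewrite -(rmorph0 (real_complex R)) (inj_eq (@complexI R)).
exists phi.
  have Sp : cvgC (series (fun n => expi (theta * (n%:R - mu)) * (p n)%:C%C)) phi.
    have -> : (fun n => expi (theta * (n%:R - mu)) * (p n)%:C%C) =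
      (expi (- (theta * mu)) / f%:C%C) *:
      (fun n => (Pcoef R k n)%:C%C * z ^+ n) :> (nat -> R[i]^o).
      apply/funext => n; rewrite fctE zX /p /GRing.scale /=.
      rewrite mulrBr expiD !rmorphM fmorphV /= [theta * n%:R]mulrC.
      ring.
    have -> : phi = (expi (- (theta * mu)) / f%:C%C) *: (g : R[i]^o).
      by rewrite /phi /GRing.scale /=; ring.
    by rewrite seriesZ; apply: cvgZl_tmp; exact: Sg.
  have [SR SI] := (cvgC_seriesP _ _).1 Sp.
  have bd (h : R -> R) : (forall x, `|h x| <= 1) ->
      cvgn (series (fun n => `|h (theta * (n%:R - mu))| * p n)).
    move=> h1; apply: (@cvg_series_dominated _ p) => [n|].
      by rewrite normrM normr_id (ger0_norm (p0 n)) ler_piMl.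
    exact: cvgP q0.
  have eR : (fun n => Re (expi (theta * (n%:R - mu)) * (p n)%:C%C)) =
      (fun n => cos (theta * (n%:R - mu)) * p n).
    by apply/funext => n /=; rewrite mulr0 subr0.
  have eI : (fun n => Im (expi (theta * (n%:R - mu)) * (p n)%:C%C)) =
      (fun n => sin (theta * (n%:R - mu)) * p n).
    by apply/funext => n /=; rewrite mulr0 add0r.
  rewrite eR in SR; rewrite eI in SI.
  rewrite (law_expectation (g := fun n => cos (theta * (n%:R - mu))) lawp _ SR).
    rewrite (law_expectation (g := fun n => sin (theta * (n%:R - mu))) lawp _ SI).
      by rewrite /=; case: (phi).
    by apply: bd => x; rewrite ler_norml sin_geN1 sin_le1.
  by apply: bd => x; rewrite ler_norml cos_geN1 cos_le1.
pose G n := \prod_(i < n) (1 - t ^+ (i.+1 ^ k))^-1.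
have fac n : \prod_(i < n) geom_char (geom_mean k t i) ((i.+1 ^ k)%:R * theta) =
  expi (- (theta * partial_mean k t n)) *
  (\prod_(i < n) (1 - z ^+ (i.+1 ^ k))^-1 / (G n)%:C%C).
  rewrite /G rmorph_prod /= -prodf_div /partial_mean mulr_sumr -sumrN expi_sum.
  rewrite -big_split /=; apply: eq_bigr => i _; rewrite /geom_char.
  congr (expi _ * _); first by ring.
  have q10 := subr_part_gt0 k i t01.
  rewrite fmorphV invrK zX /geom_mean; set q := t ^+ _ in q10 *.
  set e := expi _.
  have d0 : 1 - q%:C%C * e != 0.
    rewrite /e /q -zX; apply: subr_expC_neq0 => //; by rewrite expn_gt0.
  have q1' : (1 - q)%:C%C != 0 :> R[i].
    by rewrite -(rmorph0 (real_complex R)) (inj_eq (@complexI R)) gt_eqF.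
  have -> : 1 - (q / (1 - q))%:C%C * (e - 1) = (1 - q%:C%C * e) / (1 - q)%:C%C.
    rewrite rmorphM fmorphV /= rmorphB rmorph1 /= in q1' *.
    by field.
  by rewrite invf_div mulrC.
have -> : (fun n => \prod_(i < n) geom_char (geom_mean k t i) ((i.+1 ^ k)%:R * theta)) =
  (fun n => expi (- (theta * partial_mean k t n)) *
  (\prod_(i < n) (1 - z ^+ (i.+1 ^ k))^-1 / (G n)%:C%C)) by apply/funext.
apply: (@cvgM R[i]).
  have cm : (fun n => - (theta * partial_mean k t n)) @ \oo --> - (theta * mu).
    by apply: cvgN; apply: cvgMl_tmp.
  apply/cvgC_ReIm; split => /=.
    by apply: (cvg_comp _ _ cm); exact: continuous_cos.
  by apply: (cvg_comp _ _ cm); exact: continuous_sin.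
apply: (@cvgM R[i]); first exact: Gg.
have GC : cvgC (fun n => (G n)%:C%C) f%:C%C by apply: cvgC_real; exact: cG.
exact: (cvgV fC0 GC).
Qed.

End KhinchinLaw.

(** * Estimates at a fixed parameter *)

(** Straight from the definition: the integral of a nonnegative function is a
    supremum over the simple functions below it. *)
Lemma le_integral_restrict (d : measure_display) (T : measurableType d)
    (R : realType) (mu : {measure set T -> \bar R}) (D : set T)
    (f g : T -> \bar R) :
  (forall x, D x -> (0 <= f x)%E) -> (forall x, (0 <= g x)%E) ->
  (forall x, D x -> (f x <= g x)%E) ->
  (\int[mu]_(x in D) f x <= \int[mu]_x g x)%E.
Proof.
move=> f0 g0 fg; rewrite ge0_integralE // ge0_integralTE //.
apply: le_ereal_sup => _ [h hf <-]; exists h => // x.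
apply: le_trans (hf x) _; rewrite /patch; case: ifPn => // xD.
by apply: fg; rewrite inE in xD.
Qed.

Section Estimates.
Context (R : realType) (k : nat).
Hypothesis k1 : (1 <= k)%N.

(** Let N >= K be the integer part of (2 s)^(-1/k); the variance is of order
    N / s^2. The second bound is [char_domination] at theta = u / sigma, where
    N (theta / s)^2 is of order u^2. The third one compares the product of the
    characteristic functions with the product of the Gaussians of the same
    variances: the error is of order N s^(-3) |theta|^3, that is |u|^3 N^(-1/2).
    Both bounds are proved for finite products and passed to the limit. *)
Lemma khinchin_estimates : exists2 C : R, 0 < C & forall (s : R) (K : nat),
  0 < s <= 1 -> (7 <= K)%N -> 2 * s * (K ^ k)%:R <= 1 ->
  forall (d : measure_display) (T : measurableType d) (P : probability T R)
    (X : {RV P >-> nat}),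
  (forall n, P (X @^-1` [set n]) = (Pcoef R k n * (1 - s) ^+ n /
     limn (pseries (Pcoef R k) (1 - s)))%:E) ->
  let Y (w : T) : R := (X w)%:R in
  [/\ (K%:R%:E <= 'V_P[Y])%E,
      forall u, `|u| <= pi * stddev P Y ->
        Normc.normc (char_fun P (normalized P Y) u) <= C / (1 + u ^+ 2)
    & forall u, Normc.normc (char_fun P (normalized P Y) u -
        (expR (- (u ^+ 2 / 2)))%:C%C) <= C * `|u| ^+ 3 / Num.sqrt K%:R].
Proof.
have [C C0 dom] := char_domination R k1.
pose c2 : R := 18 * 5 ^+ 5.
have c20 : 1 <= c2 by rewrite /c2; lra.
pose C1 := Num.sqrt C.
have C10 : 0 < C1 by rewrite sqrtr_gt0.
exists (C1 * c2 + 16 * c2) => [|s K s01 K7 sK d T P X law Y].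
  by rewrite addr_gt0 ?mulr_gt0 // (lt_le_trans ltr01).
have /andP[s0 s1] := s01.
have t01 : 0 <= 1 - s < 1 by rewrite subr_ge0 s1 gtrBl.
have s20 : 0 < 2 * s by rewrite mulr_gt0.
have [N [sN sN1]] := floor_root k1 s20.
have KN : (K <= N)%N.
  rewrite leqNgt; apply/negP => NK; move: sN1; rewrite ltNge => /negP; apply.
  by apply: le_trans sK; rewrite ler_pM2l // ler_nat leq_exp2r.
have N7 := leq_trans K7 KN; have N0 : (0 < N)%N by apply: leq_trans N7.
have [mu [v [mE VE cV phiP]]] := khinchin_law k1 t01 law.
have NR : 0 < N%:R :> R by rewrite ltr0n.
have KR : 0 < K%:R :> R by rewrite ltr0n (leq_trans _ K7).
have vge : N%:R / (2 * s ^+ 2) <= v.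
  apply: cvgr_to_ge cV _; near=> n; apply: partial_var_ge => //.
  by near: n; exists N.
have vle : v <= c2 * N%:R / s ^+ 2.
  by apply: cvgr_to_le cV _; apply: nearW => n; exact: partial_var_le.
have v0 : 0 < v.
  by apply: lt_le_trans vge; rewrite divr_gt0 // mulr_gt0 // exprn_gt0.
have sE : stddev P Y = Num.sqrt v by rewrite /stddev VE.
set sg := Num.sqrt v in sE.
have sg0 : 0 < sg by rewrite sqrtr_gt0.
have sg2 : sg ^+ 2 = v by rewrite sqr_sqrtr // ltW.
have charE u phi : (phi = fine 'E_P[fun w => cos (u / sg * (Y w - mu))] +i*
      fine 'E_P[fun w => sin (u / sg * (Y w - mu))])%C ->
    char_fun P (normalized P Y) u = phi.
  move=> ->; rewrite /char_fun; congr (fine 'E_P[_] +i* fine 'E_P[_])%C;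
    apply/funext => w; rewrite /normalized mE sE; congr (_ _); ring.
have w0 i : 0 <= geom_mean k (1 - s) i by exact: geom_mean_ge0.
split.
- rewrite VE lee_fin; apply: le_trans vge.
  apply: (@le_trans _ _ N%:R); first by rewrite ler_nat.
  rewrite ler_pdivlMr ?mulr_gt0 ?exprn_gt0 //.
  have K1 : 1 <= (K ^ k)%:R :> R by rewrite ler1n expn_gt0 (leq_trans _ K7).
  have s2 : 2 * s <= 1 by apply: le_trans sK; rewrite ler_peMr // ltW.
  by rewrite ler_piMr ?(ltW NR) // expr2; nra.
- move=> u up; have [phi /charE -> cphi] := phiP (u / sg).
  set th := u / sg in cphi.
  have thp : `|th| <= pi.
    by rewrite /th normrM normfV (gtr0_norm sg0) ler_pdivrMr // -sE.
  pose X2 := N%:R * (th / s) ^+ 2.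
  have X20 : 0 <= X2 by rewrite mulr_ge0 ?sqr_ge0.
  have u2 : u ^+ 2 <= c2 * X2.
    have -> : u ^+ 2 = v * th ^+ 2 by rewrite -sg2 /th; field; rewrite gt_eqF.
    have -> : c2 * X2 = c2 * N%:R / s ^+ 2 * th ^+ 2.
      by rewrite /X2; field; rewrite gt_eqF.
    by rewrite ler_wpM2r ?sqr_ge0.
  have bound n : (N <= n)%N -> Normc.normc (\prod_(i < n)
      geom_char (geom_mean k (1 - s) i) ((i.+1 ^ k)%:R * th)) <= C1 / (1 + X2).
    move=> Nn; have H := dom s N n th s01 sN N7 Nn thp.
    rewrite -(ler_pXn2r (n := 2)) ?nnegrE ?normc_ge0 //; last first.
      by rewrite divr_ge0 ?(ltW C10) // addr_ge0.
    rewrite normc_prod expr_div_n sqr_sqrtr ?(ltW C0) // -prodrXl.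
    have -> : \prod_(i < n) Normc.normc (geom_char (geom_mean k (1 - s) i)
        ((i.+1 ^ k)%:R * th)) ^+ 2 = (\prod_(i < n) damping k s th i)^-1.
      by rewrite -prodfV; apply: eq_bigr => i _; exact: normc_geom_char_sqr.
    have P0 : 0 < \prod_(i < n) damping k s th i.
      by rewrite prodr_gt0 // => i _; rewrite (lt_le_trans ltr01) // damping_ge1.
    rewrite ler_pdivlMr ?exprn_gt0 ?ltr_wpDr // mulrC ler_pdivrMr //.
  have nphi : Normc.normc phi <= C1 / (1 + X2).
    apply: cvgr_to_le (cvgC_normc cphi) _; near=> n; apply: bound.
    by near: n; exists N.
  apply: le_trans nphi _; rewrite ler_pdivrMr ?ltr_wpDr // mulrAC.
  rewrite ler_pdivlMr ?ltr_wpDr ?sqr_ge0 //.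
  apply: (@le_trans _ _ (C1 * (c2 * (1 + X2)))).
    by rewrite ler_wpM2l ?(ltW C10) // mulrDr mulr1 lerD.
  by rewrite mulrA ler_wpM2r ?addr_ge0 // lerDl mulr_ge0 // (le_trans ler01).
- move=> u; have [phi /charE -> cphi] := phiP (u / sg).
  set th := u / sg in cphi.
  have u2 : u ^+ 2 = v * th ^+ 2 by rewrite -sg2 /th; field; rewrite gt_eqF.
  pose b i := (expR (- (geom_mean k (1 - s) i * (1 + geom_mean k (1 - s) i) *
     ((i.+1 ^ k)%:R * th) ^+ 2 / 2)))%:C%C : R[i].
  have bE n : \prod_(i < n) b i = (expR (- (partial_var k (1 - s) n * th ^+ 2 / 2)))%:C%C.
    rewrite /b -rmorph_prod /= -expR_sum; congr (_ _)%:C%C.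
    rewrite sumrN /partial_var !mulr_suml; congr (- _).
    by apply: eq_bigr => i _; rewrite exprMn; ring.
  have cb : cvgC (fun n => \prod_(i < n) b i) (expR (- (u ^+ 2 / 2)))%:C%C.
    rewrite u2; under eq_fun do rewrite bE.
    have cc : (fun n => - (partial_var k (1 - s) n * th ^+ 2 / 2)) @ \oo -->
        - (v * th ^+ 2 / 2).
      by apply: cvgN; apply: cvgMr_tmp; apply: cvgMr_tmp.
    have ce : (fun n => expR (- (partial_var k (1 - s) n * th ^+ 2 / 2))) @ \oo
        --> expR (- (v * th ^+ 2 / 2)).
      by apply: (cvg_comp _ _ cc); exact: continuous_expR.
    exact: cvgC_real.
  have b1 i : Normc.normc (b i) <= 1.
    rewrite normc_real ger0_norm ?expR_ge0 // -[leRHS]expR0 ler_expR oppr_le0.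
    by rewrite divr_ge0 // mulr_ge0 ?sqr_ge0 // geom_var_ge0.
  have th3 n : Normc.normc (\prod_(i < n)
      geom_char (geom_mean k (1 - s) i) ((i.+1 ^ k)%:R * th) - \prod_(i < n) b i)
      <= 4 * (c2 * N%:R / s ^+ 3) * `|th| ^+ 3.
    apply: (le_trans (@normc_prod_sub R (fun i => geom_char
      (geom_mean k (1 - s) i) ((i.+1 ^ k)%:R * th)) b n _ b1)).
      by move=> i; exact: normc_geom_char_le1.
    apply: (@le_trans _ _ (4 * partial_third k (1 - s) n * `|th| ^+ 3)).
      rewrite /partial_third mulr_sumr mulr_suml; apply: ler_sum => i _.
      apply: le_trans (geom_char_gauss _ (w0 i)) _.
      rewrite normrM exprMn ger0_norm //; set w := geom_mean _ _ _.
      by rewrite le_eqVlt; apply/orP; left; apply/eqP; ring.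
    rewrite ler_wpM2r ?exprn_ge0 // ler_wpM2l //.
    exact: partial_third_le.
  have Z : Normc.normc (phi - (expR (- (u ^+ 2 / 2)))%:C%C) <=
      4 * (c2 * N%:R / s ^+ 3) * `|th| ^+ 3.
    by apply: normc_lim_le th3; exact: cvgB cphi cb.
  apply: (le_trans Z).
  have sv : N%:R / 2 <= (s * sg) ^+ 2.
    rewrite exprMn sg2; move: vge.
    by rewrite ler_pdivrMr ?mulr_gt0 ?exprn_gt0 //; lra.
  have ss0 : 0 < s * sg by rewrite mulr_gt0.
  set q := Num.sqrt K%:R.
  have q0 : 0 < q by rewrite sqrtr_gt0.
  have qs : q / 2 <= s * sg.
    rewrite -(ler_pXn2r (n := 2)) ?nnegrE ?(ltW ss0) ?divr_ge0 ?(ltW q0) //.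
    apply: le_trans sv; rewrite expr_div_n sqr_sqrtr ?(ltW KR) //.
    have : K%:R <= N%:R :> R by rewrite ler_nat.
    lra.
  have -> : 4 * (c2 * N%:R / s ^+ 3) * `|th| ^+ 3 =
      8 * c2 * `|u| ^+ 3 * ((N%:R / 2) / (s * sg) ^+ 3).
    rewrite /th normrM normfV (gtr0_norm sg0); field.
    by rewrite !gt_eqF.
  have L : (N%:R / 2) / (s * sg) ^+ 3 <= 2 / q.
    apply: (@le_trans _ _ (s * sg)^-1).
      rewrite ler_pdivrMr ?exprn_gt0 // exprSr mulrCA mulVf ?gt_eqF // mulr1.
      exact: sv.
    by rewrite -[leRHS]invf_div lef_pV2 ?posrE ?divr_gt0.
  apply: (@le_trans _ _ (8 * c2 * `|u| ^+ 3 * (2 / q))).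
    by rewrite ler_wpM2l // !mulr_ge0 ?exprn_ge0 // (le_trans ler01).
  have -> : 8 * c2 * `|u| ^+ 3 * (2 / q) = 16 * c2 * (`|u| ^+ 3 / q) by ring.
  rewrite -[leRHS]mulrA ler_wpM2r ?divr_ge0 ?exprn_ge0 ?(ltW q0) //.
  by rewrite lerDr mulr_ge0 ?(ltW C10) // (le_trans ler01).
Unshelve. all: by end_near. Qed.

End Estimates.

(** * Vanishing of the Gaussian defect *)

Section GaussianLimit.
Context (R : realType).
Let mu := @lebesgue_measure R.

Lemma integrable_oneDsqrV :
  mu.-integrable [set: R] (fun x => ((1 + x ^+ 2)^-1)%:E).
Proof.
have ge1 (x : R) : 1 <= 1 + x ^+ 2 by rewrite lerDl sqr_ge0.
have ge0 (x : R) : 0 <= (1 + x ^+ 2)^-1.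
  by rewrite invr_ge0 (le_trans ler01).
have cont : continuous (fun x : R => (1 + x ^+ 2)^-1).
  exact: (@continuous_oneDsqrV R).
apply/integrableP; split.
  by apply/measurable_EFinP; exact: continuous_measurable_fun.
under eq_integral do rewrite gee0_abs ?lee_fin //.
rewrite ge0_symfun_integralT //; last by move=> x; rewrite /= sqrrN.
by rewrite -set_itvcy (integral0y_oneDsqr R) -EFinM ltry.
Qed.

(** A majorant of the integrand of the Gaussian defect that depends on the
    parameter t only through the scale K. *)
Definition gap_bound (C : R) (K : nat) (x : R) : R :=
  Num.min (C * `|x| ^+ 3 / Num.sqrt K%:R) (C / (1 + x ^+ 2)).

Lemma gap_bound_ge0 C K x : 0 <= C -> 0 <= gap_bound C K x.
Proof.
move=> C0; rewrite /gap_bound le_min !divr_ge0 ?mulr_ge0 ?exprn_ge0 ?sqrtr_ge0 //.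
by rewrite addr_ge0 ?sqr_ge0.
Qed.

Lemma measurable_gap_bound C K : measurable_fun [set: R] (gap_bound C K).
Proof.
apply: measurable_minr.
  apply: measurable_funM => //; apply: measurable_funM => //.
  by apply: measurable_funX; exact: normr_measurable.
apply: measurable_funM => //.
by apply: continuous_measurable_fun; exact: (@continuous_oneDsqrV R).
Qed.

Lemma cvg_integral_gap_bound (C : R) : 0 <= C ->
  (fun K => \int[mu]_x (gap_bound C K x)%:E)%E @ \oo --> 0%E.
Proof.
move=> C0.
have := @dominated_convergence _ _ R mu setT measurableT
  (fun K x => (gap_bound C K x)%:E) (cst 0%E) (fun x => (C / (1 + x ^+ 2))%:E).
case=> //.
- by move=> K; apply/measurable_EFinP; exact: measurable_gap_bound.
- apply/aeW => x _.
  rewrite -[X in _ --> X]/((0 : R)%:E).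
  apply: cvg_EFin; first exact: nearW.
  apply: (@squeeze_cvgr _ _ _ _ (fun=> 0) (fun K => C * `|x| ^+ 3 / Num.sqrt K%:R)).
  + by apply: nearW => K; rewrite gap_bound_ge0 // ge_min lexx.
  + exact: cvg_cst.
  + rewrite -[X in _ --> X](mulr0 (C * `|x| ^+ 3)); apply: cvgMl_tmp.
    apply/cvgrPdist_le => e e0; near=> K.
    have K0 : 0 < K%:R :> R by rewrite ltr0n; near: K; exists 1%N.
    rewrite sub0r normrN ger0_norm ?invr_ge0 ?sqrtr_ge0 //.
    rewrite -[leRHS]invrK lef_pV2 ?posrE ?invr_gt0 ?sqrtr_gt0 //.
    rewrite -(ler_pXn2r (n := 2)) ?nnegrE ?invr_ge0 ?sqrtr_ge0 ?(ltW e0) //.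
    rewrite sqr_sqrtr ?(ltW K0) //.
    near: K; exists (Num.truncn (e^-1 ^+ 2)).+1 => // n /= Hn.
    apply/ltW; rewrite -truncn_lt_nat ?exprn_ge0 ?invr_ge0 ?(ltW e0) //.
- have -> : (fun x : R => (C / (1 + x ^+ 2))%:E) =
     (fun x => C%:E * ((1 + x ^+ 2)^-1)%:E)%E by apply/funext.
  by apply: integrableZl => //; exact: integrable_oneDsqrV.
- apply/aeW => x K _; rewrite gee0_abs ?lee_fin ?gap_bound_ge0 //.
  by rewrite ge_min lexx orbT.
by move=> _ _; rewrite integral0.
Unshelve. all: by end_near. Qed.

Lemma expR_half_sqr_le (u : R) : expR (- (u ^+ 2 / 2)) <= 2 / (1 + u ^+ 2).
Proof.
have u2 : 0 < 1 + u ^+ 2 by rewrite ltr_wpDr ?sqr_ge0.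
rewrite expRN ler_pdivlMr // mulrC ler_pdivrMr ?expR_gt0 //.
have := expR_ge1Dx (u ^+ 2 / 2); lra.
Qed.

End GaussianLimit.

(** Once 2 (1 - t) K^k <= 1, the variance is at least K and the defect is at most
    the integral of [gap_bound], which tends to 0 as K grows by dominated
    convergence. *)
Lemma khinchin_strongly_gaussian (R : realType) (k : nat) (hk : (1 <= k)%N)
    (d : R -> measure_display) (T : forall t, measurableType (d t))
    (P : forall t, probability (T t) R) (X : forall t, {RV (P t) >-> nat}) :
  khinchin_family (Pcoef R k) X -> strongly_gaussian 1 X.
Proof.
move=> [_ law].
have [C C0 est] := khinchin_estimates R hk.
have C2 : 0 <= C + 2 by rewrite addr_ge0 // ltW.
have near1 (K : nat) : (7 <= K)%N -> \forall t \near (1 : R)^'-,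
    let Y (w : T t) : R := (X t w)%:R in
    (K%:R%:E <= 'V_(P t)[Y])%E /\
    (gaussian_defect (P t) Y <=
     \int[@lebesgue_measure R]_x (gap_bound (C + 2) K x)%:E)%E.
  move=> K7; have K0 : 0 < (K ^ k)%:R :> R.
    by rewrite ltr0n expn_gt0 (leq_trans _ K7).
  have e0 : 0 < (2 * (K ^ k)%:R)^-1 :> R by rewrite invr_gt0 mulr_gt0.
  near=> t.
  have t1 : t < 1 by near: t; exact: nbhs_left_lt.
  have t0 : 0 < t by near: t; exact: nbhs_left_gt.
  have te : 1 - (2 * (K ^ k)%:R)^-1 < t.
    by near: t; apply: nbhs_left_gt; rewrite gtrBl.
  have s01 : 0 < 1 - t <= 1 by rewrite subr_gt0 t1 gerBl ltW.
  have sK : 2 * (1 - t) * (K ^ k)%:R <= 1.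
    rewrite mulrAC -ler_pdivlMl ?mulr_gt0 // mulr1; lra.
  have lawt n : P t (X t @^-1` [set n]) = (Pcoef R k n * (1 - (1 - t)) ^+ n /
      limn (pseries (Pcoef R k) (1 - (1 - t))))%:E.
    by rewrite subKr; apply: law; rewrite // cvg_radius_Pcoef // lte_fin.
  have [VK dom clt] := est _ K s01 K7 sK _ _ _ _ lawt.
  split; first exact: VK.
  apply: le_integral_restrict => [u _|u|u].
  - by rewrite lee_fin normc_ge0.
  - by rewrite lee_fin gap_bound_ge0.
  move=> ui; have /andP[ul ur] : - (pi * stddev (P t) (fun w => (X t w)%:R)) <= u
      <= pi * stddev (P t) (fun w => (X t w)%:R) by move: ui; rewrite /= in_itv.
  rewrite lee_fin /gap_bound le_min.
  apply/andP; split.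
    apply: le_trans (clt u) _; rewrite ler_wpM2r ?invr_ge0 ?sqrtr_ge0 //.
    by rewrite ler_wpM2r ?exprn_ge0 // lerDl.
  apply: le_trans (le_normcD _ _) _; rewrite normcN normc_real mulrDl.
  rewrite ger0_norm ?expR_ge0 // lerD ?expR_half_sqr_le //.
  by apply: dom; rewrite ler_norml ul ur.
split.
  apply/cvgeyPge => A.
  pose K := maxn 7 (Num.truncn A).+1.
  apply: filterS (near1 K (leq_maxl _ _)) => t [VK _].
  apply: le_trans VK; rewrite lee_fin.
  apply: (@le_trans _ _ (Num.truncn A).+1%:R); first exact/ltW/truncnS_gt.
  by rewrite ler_nat leq_maxr.
have I0 := cvg_integral_gap_bound C2.
have defect_ge0 t : (0 <= gaussian_defect (P t) (fun w => (X t w)%:R))%E.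
  by apply: integral_ge0 => u _; rewrite lee_fin normc_ge0.
have small (e : R) : 0 < e -> \forall t \near (1 : R)^'-,
    (gaussian_defect (P t) (fun w => (X t w)%:R) <= e%:E)%E.
  move=> e0; move/fine_cvgP: I0 => [Ifin /cvgrPdist_le/(_ _ e0) Ie].
  have [K [K7 Kfin Ke]] : exists K, [/\ (7 <= K)%N,
     (\int[@lebesgue_measure R]_x (gap_bound (C + 2) K x)%:E \is a fin_num)%E &
     `|0 - fine (\int[@lebesgue_measure R]_x (gap_bound (C + 2) K x)%:E)| <= e].
    have [[N1 _ fin1] [N2 _ le2]] := (Ifin, Ie).
    exists (maxn 7 (maxn N1 N2)); split; first exact: leq_maxl.
      by apply: fin1; rewrite /= !leq_max leqnn orbT.
    by apply: le2; rewrite /= !leq_max leqnn !orbT.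
  apply: filterS (near1 K K7) => t [_ H]; apply: le_trans H _.
  rewrite -(fineK Kfin) lee_fin; apply: le_trans Ke.
  by rewrite sub0r normrN ler_norm.
apply/fine_cvgP; split.
  apply: filterS (small 1 ltr01) => t H.
  by rewrite ge0_fin_numE // (le_lt_trans H) // ltry.
apply/cvgrPdist_le => e e0; apply: filterS (small e e0) => t H /=.
rewrite sub0r normrN ger0_norm ?fine_ge0 // -lee_fin fineK //.
by rewrite ge0_fin_numE // (le_lt_trans H) // ltry.
Unshelve. all: by end_near. Qed.

Theorem theorem1 (R : realType) (k : nat) (hk : (1 <= k)%N) :
  [/\ classK (Pcoef R k),
      cvg_radius (Pcoef R k) = 1%:E,
      forall z : R[i], Normc.normc z < 1 ->
        exists2 p : R[i]^o, Pprod k z @ \oo --> p & Pseries k z @ \oo --> p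
    & forall (d : R -> measure_display) (T : forall t, measurableType (d t))
        (P : forall t, probability (T t) R) (X : forall t, {RV (P t) >-> nat}),
        khinchin_family (Pcoef R k) X -> strongly_gaussian 1 X].
Proof.
split.
- exact: classK_Pcoef.
- exact: cvg_radius_Pcoef.
- move=> z /(Pcoef_genfunC hk)[p prodp seriesp]; exists p; last exact: seriesp.
  suff -> : Pprod k z = (fun N => \prod_(i < N) (1 - z ^+ (i.+1 ^ k))^-1 : R[i]^o).
    exact: prodp.
  by apply/funext => N; exact: PprodE.
- by move=> d T P X; exact: khinchin_strongly_gaussian.
Qed.
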